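(* Let $G$ be a simple graph with $|V(G)|\ge 73$ and $\min\{\delta(G),\delta(G^c)\}\ge 4$. Then (i) $G\in\mathcal{S}_3$ or $G^c\in\mathcal{S}_3$, or (ii) both $G$ and $G^c$ contain a bad attachment. Moreover, in case (ii) both $\phi(G)<3$ and $\phi(G^c)<3$.
   Context: Graphs may have parallel edges but no loops. For a graph $G$, $Z(G,\mathbb{Z}_3)$ is the set of functions $\beta:V(G)\to\mathbb{Z}_3$ with $\sum_{v}\beta(v)\equiv 0\pmod 3$. A $\beta$-orientation is an orientation $D$ with $d^+_D(v)-d^-_D(v)\equiv\beta(v)\pmod 3$ for all $v$. A graph $G$ belongs to $\mathcal{S}_3$ (is strongly-connected $\mathbb{Z}_3$-contractible) if for every $\beta\in Z(G,\mathbb{Z}_3)$ there is a strongly-connected $\beta$-orientation of $G$. A bad attachment of $G$ is an induced subgraph $\Gamma$ with $3\le|V(\Gamma)|\le 6$ such that the number of edges of $G$ between $V(\Gamma)$ and $V(G)\setminus V(\Gamma)$ is at most $3|V(\Gamma)|-|E(\Gamma)|$. The flow index $\phi(G)$ is the least rational $r=k/d$ such that $G$ admits a circular $k/d$-flow, i.e. an orientation and integer flow with all values in $\{\pm d,\dots,\pm(k-d)\}$; $\phi(G)=\infty$ if none exists. *)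

(* Defs.v *)
From HB Require Import structures.
From mathcomp Require Import all_boot all_order all_algebra.
Set Implicit Arguments. Unset Strict Implicit. Unset Printing Implicit Defensive.
Import Order.TTheory GRing.Theory Num.Theory.

Section Graphs.
Variable T : finType.

Definition simple_graph (e : rel T) : Prop := symmetric e /\ irreflexive e.

Definition compl_graph (e : rel T) : rel T := fun x y => (x != y) && ~~ e x y.

Definition deg (e : rel T) (v : T) : nat := #|[set u | e v u]|.

Definition edges (e : rel T) : {set {set T}} :=
  [set A : {set T} | [exists x, exists y, (A == [set x; y]) && e x y]].

Definition orientation (e o : rel T) : Prop :=
  (forall x y, o x y -> e x y) /\ (forall x y, e x y -> o x y != o y x).

Definition outdeg (o : rel T) (v : T) : nat := #|[set u | o v u]|.
Definition indeg (o : rel T) (v : T) : nat := #|[set u | o u v]|.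

Definition beta_orientation (o : rel T) (beta : T -> 'Z_3) : Prop :=
  forall v, ((outdeg o v)%:R - (indeg o v)%:R)%R = beta v.

Definition strongly_connected (o : rel T) : Prop :=
  forall x y, connect o x y.

Definition S3 (e : rel T) : Prop :=
  forall beta : T -> 'Z_3, (\sum_(v : T) beta v = 0)%R ->
    exists o : rel T, [/\ orientation e o, strongly_connected o &
                          beta_orientation o beta].

(* bad attachment: vertex set S of the induced subgraph Gamma = G[S] *)
Definition bad_attachment (e : rel T) (S : {set T}) : Prop :=
  [/\ 3 <= #|S| <= 6 &
      #|[set A in edges e | #|A :&: S| == 1]|
        + #|[set A in edges e | A \subset S]| <= 3 * #|S| ].

Definition has_bad_attachment (e : rel T) : Prop :=
  exists S : {set T}, bad_attachment e S.

Definition circular_flow (e : rel T) (k d : nat) : Prop :=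
  exists (o : rel T) (f : T -> T -> int),
    [/\ orientation e o,
        (forall x y, o x y -> (d%:Z <= `|f x y|)%R /\ (`|f x y| <= k%:Z - d%:Z)%R) &
        forall v, (\sum_(u | o v u) f v u = \sum_(u | o u v) f u v)%R].

(* phi(G) < 3: G admits a circular k/d-flow for some rational k/d < 3
   (the flow index is a minimum, so this is equivalent) *)
Definition flow_index_lt3 (e : rel T) : Prop :=
  exists k d : nat, [/\ 0 < d, k < 3 * d & circular_flow e k d].

End Graphs.

(* Main.v *)
(* Call H a maximal vertex set of G inducing a member of S_3.  Orientations with prescribed net
   degrees exist as soon as the cuts allow them (Hakimi); this gives S_3 for graphs with large
   cuts, and, by splitting along small cuts, a member of S_3 on at least 24 vertices in one of the
   two graphs, say in G.  By maximality each vertex of W = V - H has at most 3 edges to H.  Define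
   the deficit of W as 3|W| minus the number of edges between W and H.  A set of small deficit
   with too many edges touching it could be absorbed into H, so a deficit at most 6 forces W to
   be a bad attachment of at most 6 vertices, and the deficit is always at least 3.
   In the complement, W is almost completely joined to H; taking few vertices of W as hubs and
   splitting off pairs of edges at vertices of H, one builds a member of S_3 containing W.  A
   maximal one H' leaves out a set X disjoint from W, and since every pair of W x X is an edge of
   G or of its complement, the two deficits sum to at most 9.  So both are at most 6.
   For the flows only the zero boundary has to be extended to W, which has at most two vertices of
   odd degree, and a strong modulo 3 orientation gives a circular flow of index below 3. *)
Require Import Defs.
From HB Require Import structures.
From mathcomp Require Import all_boot all_order all_algebra.
From mathcomp Require Import zify ring.
From Stdlib Require Import Classical_Prop.
Set Implicit Arguments. Unset Strict Implicit. Unset Printing Implicit Defensive.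
Import Order.TTheory GRing.Theory Num.Theory.
Local Open Scope ring_scope.

(** * Orientations of multigraphs *)

(** Splitting off edges creates parallel ones, so S_3 is studied for multigraphs. Strong
    connectivity comes for free from strict cut inequalities: a cut whose net degree is smaller in
    absolute value than its size has arcs in both directions. The obstacle is absorption. The
    boundary fixes out-degrees modulo 3, and it remains to choose which of them to raise by 3. A
    deficit at most 6 allows at most 7 inner edges, hence total excess at most 3. Excess up to 2 is
    settled by uncrossing, excess 3 occurs only on 4 or 5 vertices and is settled by enumeration.
    The constant 24 is 12 + 12: four hubs send at most 12 edges to H, and a tree on them with each
    edge taken four times has 12 edges, each realised by its own vertex of H. The constant 73 makes
    half of all pairs exceed the extremal bound for graphs without a member of S_3 on 24
    vertices. *)

Section Multigraphs.
Variable T : finType.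
Implicit Types (m x y : T -> T -> nat) (X Y : T -> T -> int) (U H S : {set T}).
Implicit Types (b beta : T -> int).

Lemma PoszS I (r : seq I) (P : pred I) (F : I -> nat) :
  (\sum_(i <- r | P i) F i)%N%:Z = \sum_(i <- r | P i) (F i)%:Z.
Proof. exact: (big_morph Posz PoszD). Qed.

Lemma sumzB I (r : seq I) (P : pred I) (F G : I -> int) :
  \sum_(i <- r | P i) (F i - G i) = \sum_(i <- r | P i) F i - \sum_(i <- r | P i) G i :> int.
Proof. exact: sumrB. Qed.

Lemma sumzD I (r : seq I) (P : pred I) (F G : I -> int) :
  \sum_(i <- r | P i) (F i + G i) = \sum_(i <- r | P i) F i + \sum_(i <- r | P i) G i :> int.
Proof. exact: big_split. Qed.

Lemma sumzN I (r : seq I) (P : pred I) (F : I -> int) :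
  \sum_(i <- r | P i) - F i = - \sum_(i <- r | P i) F i :> int.
Proof. exact: sumrN. Qed.

Definition netz X U v : int := \sum_(u in U) (X v u - X u v).
Definition net x U v : int := netz (fun u v => (x u v)%:Z) U v.

Definition delta (a c : T) (u v : T) : int := ((u == a) && (v == c))%:Z.

Lemma sum_pred1z (U : {set T}) (a : T) : a \in U ->
  \sum_(u in U) (u == a)%:Z = 1 :> int.
Proof.
move=> aU; rewrite (bigD1 a) //= eqxx big1 ?addr0 // => u /andP[_ /negPf->] //.
Qed.

Lemma sum_pred1n (U : {set T}) (a : T) : (\sum_(u in U) (u == a) = (a \in U))%N.
Proof.
case aU: (a \in U); first by rewrite (bigD1 a) //= eqxx big1 // => v /andP[_ /negPf->].
by rewrite big1 // => v vU; case: eqP => // va; rewrite -va vU in aU.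
Qed.

Lemma netz_delta a c U v : a \in U -> c \in U ->
  netz (delta a c) U v = (v == a)%:Z - (v == c)%:Z.
Proof.
move=> aU cU; rewrite /netz sumrB /delta; congr (_ - _).
  case: eqP => /= _; first exact: sum_pred1z.
  by rewrite big1.
case: eqP => /= _.
  under eq_bigr do rewrite andbT; exact: sum_pred1z.
by rewrite big1 // => u _; rewrite andbF.
Qed.

Lemma netzD X Y U v :
  netz (fun u v => X u v + Y u v) U v = netz X U v + netz Y U v.
Proof. by rewrite /netz -big_split; apply: eq_bigr => u _ /=; ring. Qed.

Lemma netzN X U v : netz (fun u v => - X u v) U v = - netz X U v.
Proof. by rewrite /netz -sumrN; apply: eq_bigr => u _ /=; ring. Qed.

Lemma eq_netz X Y U v : {in U, X v =1 Y v} ->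
  {in U, forall u, X u v = Y u v} -> netz X U v = netz Y U v.
Proof. by move=> E1 E2; apply: eq_bigr => u uU; rewrite E1 // E2. Qed.

Lemma sum_netz_self X S : \sum_(v in S) netz X S v = 0.
Proof.
rewrite /netz; under eq_bigr do rewrite sumrB.
by rewrite sumrB [X in _ - X]exchange_big subrr.
Qed.

Lemma netz_setD X U S v : S \subset U ->
  netz X U v = netz X S v + netz X (U :\: S) v.
Proof. by move=> SU; rewrite /netz (big_setID S) /= (setIidPr SU). Qed.

Lemma sum_netz X U S : S \subset U ->
  \sum_(v in S) netz X U v = \sum_(v in S) netz X (U :\: S) v.
Proof.
move=> SU; under eq_bigr do rewrite (netz_setD _ _ SU).
by rewrite big_split /= sum_netz_self add0r.
Qed.

Definition orients m U x := {in U &, forall u v, (x u v + x v u)%N = m u v}.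

(** Strong connectivity in cut form, the form in which inequalities on net degrees deliver it. *)
Definition strong x U := forall S, S \subset U -> S != set0 -> S != U ->
  exists a c, [/\ a \in S, c \in U :\: S & (0 < x a c)%N].

Definition good m U beta x :=
  [/\ orients m U x, strong x U & {in U, forall v, (3 %| net x U v - beta v)%Z}].

(* The multigraph induced on U by the multiplicities m is in the class S_3; [beta] is integer
   valued and only matters modulo 3. *)
Definition S3on m U := forall beta, (3 %| \sum_(v in U) beta v)%Z ->
  exists x, good m U beta x.

Definition cutm m U S : nat := (\sum_(v in S) \sum_(u in U :\: S) m v u)%N.

Definition addE m a c : T -> T -> nat :=
  fun u v => (m u v + ((u == a) && (v == c)) + ((u == c) && (v == a)))%N.

(** Reversing a path moves two units of net degree from its start to its end. Uniqueness of the
    vertices keeps the rest of the path intact once its first arc has been reversed. *)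
Lemma flip_path m x p a : orients m setT x ->
  path (fun u v => 0 < x u v)%N a p -> uniq (a :: p) ->
  exists2 x', orients m setT x' &
    forall v, net x' setT v = net x setT v - 2 * (v == a)%:Z + 2 * (v == last a p)%:Z.
Proof.
elim: p x a => [|c p IH] x a ox /=.
  by move=> _ _; exists x => // v; rewrite subrK.
case/andP=> xac pth /andP[ap up].
have ac : a != c by apply: contra ap => /eqP->; rewrite inE eqxx.
pose x1 u v := (x u v - ((u == a) && (v == c)) + ((u == c) && (v == a)))%N.
have x1E u v : (x1 u v)%:Z = (x u v)%:Z + (- delta a c u v + delta c a u v).
  rewrite /x1 /delta; have := negPf ac.
  case: (eqVneq u a) => [->|_] /= E; rewrite ?E /=; last by lia.
  by case: (eqVneq v c) => [->|_] /=; lia.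
have [|||x2 o2 n2] := IH x1 c.
- move=> u v _ _; have := ox u v (in_setT _) (in_setT _).
  have := x1E u v; have := x1E v u; rewrite /delta.
  by case: (u == a); case: (u == c); case: (v == a); case: (v == c) => /=; lia.
- move: ap; rewrite inE negb_or => /andP[_ ap].
  suff K d : a \notin d :: p -> path (fun u v => 0 < x u v)%N d p ->
      path (fun u v => 0 < x1 u v)%N d p by apply: K => //; rewrite inE negb_or ac.
  elim: p d {IH pth up ap} => //= d p IHp d0; rewrite !inE !negb_or.
  move=> /andP[ad0 /andP[ad ap]] /andP[x0 pth].
  rewrite IHp ?inE ?negb_or ?ad // andbT /x1 eq_sym (negPf ad0) [d == a]eq_sym (negPf ad) andbF.
  by rewrite subn0 addn0.
- exact: up.
exists x2 => // v; rewrite n2 /= {1}/net.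
rewrite (@eq_netz _ (fun u v => (x u v)%:Z + (- delta a c u v + delta c a u v))) => [|u _|u _] //.
  rewrite !netzD netzN !netz_delta ?in_setT //. rewrite -/(net x setT v). ring.
Qed.
End Multigraphs.

(** * Orientations with prescribed net degrees *)

Section Hakimi.
Variable T : finType.
Implicit Types (m x y : T -> T -> nat) (X Y : T -> T -> int) (U H S W : {set T}).
Implicit Types (b beta : T -> int).

Lemma net_trans x U v : net (fun u v => x v u) U v = - net x U v.
Proof. by rewrite /net /netz -sumrN; apply: eq_bigr => u _; ring. Qed.

Lemma orient_parity m x b v : orients m setT x ->
  (2 %| \sum_u (m v u)%:Z - b v)%Z -> (2 %| net x setT v - b v)%Z.
Proof.
move=> ox; suff -> : \sum_u (m v u)%:Z = net x setT v + 2 * \sum_u (x u v)%:Z by lia.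
have E (F : T -> int) : \sum_u F u = \sum_(u in setT) F u.
  by apply: eq_bigl => u; rewrite inE.
rewrite /net /netz !E mulr_sumr -big_split; apply: eq_bigr => u _ /=.
by rewrite -(ox v u) ?inE //; lia.
Qed.

(* If no vertex reachable from w could receive the surplus of w, then no arc leaves the set
   of these vertices and its net degree violates the cut condition. *)
Lemma hakimi_step m x W b w : orients m setT x ->
  (forall v, v \in W -> (2 %| \sum_u (m v u)%:Z - b v)%Z) ->
  (forall S, S \subset W -> - (cutm m setT S)%:Z <= \sum_(v in S) b v) ->
  w \in W -> b w < net x setT w ->
  exists2 x', orients m setT x' &
    (\sum_(v in W) `|net x' setT v - b v| < \sum_(v in W) `|net x setT v - b v|)%N.
Proof.
move=> ox par cut wW ltw.
pose r : rel T := fun u v => (0 < x u v)%N.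
pose R := [set v | connect r w v].
have wR : w \in R by rewrite inE connect0.
have [v [vR vP]] : exists v, v \in R /\ ((v \notin W) \/ (net x setT v < b v)).
  case: (boolP [exists v in R, (v \notin W) || (net x setT v < b v)]).
    by move=> /existsP[v /andP[vR /orP]]; exists v.
  move=> /existsPn nex; exfalso.
  have RW v : v \in R -> v \in W /\ b v <= net x setT v.
    by move=> vR; have := nex v; rewrite vR /= negb_or negbK -leNgt => /andP.
  have RsW : R \subset W by apply/subsetP => v /RW[].
  have := cut R RsW.
  have : \sum_(v in R) net x setT v = - (cutm m setT R)%:Z.
    rewrite (sum_netz _ (subsetT R)) /cutm PoszS -sumrN.
    apply: eq_bigr => v vR; rewrite PoszS -sumrN.
    apply: eq_bigr => u; rewrite !inE andbT => uR.
    have xvu : x v u = 0%N.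
      apply/eqP; rewrite -leqn0 leqNgt; apply: contra uR => xvu.
      by move: vR; rewrite inE => /connect_trans; apply; apply: connect1.
    by rewrite -(ox v u) ?inE // xvu; lia.
  have : \sum_(v in R) b v < \sum_(v in R) net x setT v.
    rewrite (bigD1 w) //= [X in _ < X](bigD1 w) //= ltr_leD //.
    by apply: ler_sum => v /andP[/RW[]].
  lia.
move: vR; rewrite inE => /connectP[p pth lst].
case/shortenP: pth lst => q pq uq _ lst.
have [x' ox' n'] := flip_path ox pq uq; exists x' => //; rewrite -lst in n'.
have vw : v != w.
  by apply/eqP => vw; move: vP; rewrite vw wW => -[]//; rewrite ltNge ltW.
rewrite (bigD1 w) //= [X in (_ < X)%N](bigD1 w) //= -addSn leq_add //.
  have := orient_parity ox (par w wW); rewrite n' eqxx eq_sym (negPf vw); lia.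
apply: leq_sum => u /andP[uW uw]; rewrite n' (negPf uw).
case: eqP => [uv|_]; last by lia.
case: vP; rewrite -uv ?uW // => lt; have := orient_parity ox (par u uW); lia.
Qed.

(** Induction on the total deviation from [b]. A vertex below its target becomes one above it when
    all arcs are reversed and [b] is negated. Vertices outside [W] are free and take up any
    surplus. *)
Theorem hakimi m W b : (forall u v, m u v = m v u) -> (forall v, m v v = 0%N) ->
  (forall v, v \in W -> (2 %| \sum_u (m v u)%:Z - b v)%Z) ->
  (forall S, S \subset W -> `|\sum_(v in S) b v| <= (cutm m setT S)%:Z) ->
  exists2 x, orients m setT x & {in W, forall v, net x setT v = b v}.
Proof.
move=> sm irr par cut.
pose x0 u v := if (enum_rank u < enum_rank v)%N then m u v else 0%N.
have o0 : orients m setT x0.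
  move=> u v _ _; rewrite /x0 [m v u]sm; case: ltngtP => //; first by rewrite addn0.
  by move=> /val_inj/enum_rank_inj->; rewrite irr.
have [n] := ubnP (\sum_(v in W) `|net x0 setT v - b v|)%N.
elim: n x0 o0 => // n IH x ox; rewrite ltnS => le.
case: (boolP [exists w in W, net x setT w != b w]) => [|/existsPn H]; last first.
  by exists x => // v vW; apply/eqP; have := H v; rewrite vW negbK.
case/existsP=> w /andP[wW]; rewrite neq_lt => /orP[lt|lt]; last first.
  have [|x' ox' lt'] := hakimi_step ox par _ wW lt.
    by move=> S SW; have := cut S SW; lia.
  exact: (IH x' ox' (leq_trans lt' le)).
have oxt : orients m setT (fun u v => x v u) by move=> u v _ _; rewrite addnC ox ?inE.
have [||| x' ox' lt'] := @hakimi_step _ _ W (fun v => - b v) w oxt _ _ wW.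
- by move=> v vW; have := par v vW; lia.
- by move=> S SW; rewrite sumrN lerN2; apply: le_trans (ler_norm _) (cut S SW).
- by rewrite net_trans; lia.
have ox'' : orients m setT (fun u v => x' v u) by move=> u v _ _; rewrite addnC ox' ?inE.
apply: (IH _ ox'' (leq_trans _ le)); suff -> : (\sum_(v in W) `|net (fun u v => x' v u) setT v - b v| =
  \sum_(v in W) `|net x' setT v - - b v|)%N.
  apply: leq_trans lt' _; rewrite leq_eqVlt; apply/orP; left; apply/eqP.
  by apply: eq_bigr => v _; rewrite net_trans; lia.
by apply: eq_bigr => v _; rewrite net_trans; lia.
Qed.

End Hakimi.

(** * Extending orientations from a subset *)

Section Extension.
Variable T : finType.
Implicit Types (m x y : T -> T -> nat) (X Y : T -> T -> int) (U H S W : {set T}).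
Implicit Types (b beta : T -> int).

Definition crossing_arcs y U S :=
  (exists a c, [/\ a \in S, c \in U :\: S & (0 < y a c)%N]) /\
  (exists a c, [/\ a \in S, c \in U :\: S & (0 < y c a)%N]).

(* [y] orients the edges of H + S that touch S. *)
Definition local_good m H S beta y :=
  [/\ {in H :|: S &, forall u v, (u \in S) || (v \in S) -> (y u v + y v u)%N = m u v},
      {in S, forall v, (3 %| net y (H :|: S) v - beta v)%Z} &
      forall S', S' \subset S -> S' != set0 -> crossing_arcs y (H :|: S) S'].

Lemma bigUdisj (R : Type) (idx : R) (op : Monoid.com_law idx) (H S : {set T}) (F : T -> R) :
  [disjoint H & S] ->
  \big[op/idx]_(v in H :|: S) F v = op (\big[op/idx]_(v in H) F v) (\big[op/idx]_(v in S) F v).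
Proof.
by move=> HS; rewrite -bigU //; apply: eq_bigl => v; rewrite !inE.
Qed.

Lemma sumzU H S (F : T -> int) : [disjoint H & S] ->
  \sum_(v in H :|: S) F v = \sum_(v in H) F v + \sum_(v in S) F v :> int.
Proof. exact: bigUdisj. Qed.

Lemma netzU X H S v : [disjoint H & S] ->
  netz X (H :|: S) v = netz X H v + netz X S v.
Proof. by move=> HS; rewrite /netz; exact: bigUdisj. Qed.

(** The arcs touching [S] come from [y]; the others come from S_3 on [H], for the boundary reduced
    by what [y] contributes. A cut that splits [H] is crossed inside [H]. Otherwise one of its sides
    lies in [S], and as this may be either side, [crossing_arcs] asks for arcs in both
    directions. *)
Lemma extend m H S beta y : [disjoint H & S] -> S3on m H -> local_good m H S beta y ->
  (3 %| \sum_(v in H :|: S) beta v)%Z -> exists x, good m (H :|: S) beta x.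
Proof.
move=> HS S3H [oy ny ay] sum0.
have nHS v : v \in H -> v \notin S by move=> vH; rewrite (disjointFr HS vH).
pose Y u v := (y u v)%:Z.
have [|x [ox sx nx]] := S3H (fun v => beta v - netz Y S v).
  have : \sum_(v in H) netz Y S v = - \sum_(v in S) netz Y (H :|: S) v.
    rewrite (sum_netz _ (subsetUr H S)) setDUl setDv setU0.
    have -> : H :\: S = H by apply/setDidPl.
    rewrite /netz exchange_big /= -sumzN; apply: eq_bigr => u _.
    by rewrite -sumzN; apply: eq_bigr => v _; ring.
  have : (3 %| \sum_(v in S) (netz Y (H :|: S) v - beta v))%Z.
    by apply: (big_ind (fun z => 3 %| z)%Z) => [|a c|v vS]; [|lia|exact: ny].
  move: sum0; rewrite sumzU // !sumzB /=; lia.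
pose z u v := if (u \in S) || (v \in S) then y u v else x u v.
exists z; split.
- move=> u v uU vU; rewrite /z orbC; case: ifP => uvS.
    by apply: oy => //; rewrite orbC.
  move: uU vU uvS; rewrite !inE.
  by case: (u \in S); case: (v \in S); rewrite //= !orbF => *; apply: ox.
- move=> S0 S0U S0n S0p.
  case: (eqVneq (H :&: S0) set0) => [HS0|HS0].
    have S0S : S0 \subset S.
      apply/subsetP => v vS0; have := subsetP S0U v vS0; rewrite inE => /orP[vH|//].
      by have := in_set0 v; rewrite -HS0 inE vH vS0.
    have [[a [c [aS cS yac]]] _] := ay S0 S0S S0n.
    by exists a, c; split; rewrite // /z (subsetP S0S a aS).
  case: (eqVneq (H :&: S0) H) => [HS1|HS1]; last first.
    have [a [c [aI cD xac]]] := sx (H :&: S0) (subsetIl _ _) HS0 HS1.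
    move: aI cD; rewrite !inE => /andP[aH aS0] /andP[cN cH]; rewrite cH /= in cN.
    by exists a, c; rewrite !inE cH cN aS0 /z !(negPf (nHS _ _)).
  have HsS0 : H \subset S0 by rewrite -HS1 subsetIr.
  have DS : (H :|: S) :\: S0 \subset S.
    apply/subsetP => v; rewrite !inE => /andP[vS0 /orP[vH|//]].
    by rewrite (subsetP HsS0 v vH) in vS0.
  have [|_ [a [c []]]] := ay _ DS.
    apply: contra S0p => /eqP E; rewrite eqEsubset S0U /=; apply/subsetP => v vU.
    by apply/negPn/negP => vS0; have := in_set0 v; rewrite -E inE vS0 vU.
  move=> aD cD yca; exists c, a; split=> //.
    by move: cD; rewrite !inE; case: (c \in S0) => //=; case: (_ || _).
  by rewrite /z (subsetP DS a aD) orbT.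
- move=> v; rewrite inE => /orP[vH|vS]; last first.
    rewrite /net (@eq_netz _ _ Y) => [|u _|u _]; rewrite /z ?vS ?orbT //; exact: ny.
  rewrite /net netzU // (@eq_netz _ _ (fun u v => (x u v)%:Z)) => [|u uH|u uH];
    rewrite /z ?(negPf (nHS _ _)) //.
  rewrite [netz _ S v](@eq_netz _ _ Y) => [|u uS|u uS]; rewrite /z ?uS ?orbT //.
  by have := nx v vH; rewrite /net; lia.
Qed.

Lemma S3on_extend m H S : [disjoint H & S] -> S3on m H ->
  (forall beta, exists y, local_good m H S beta y) -> S3on m (H :|: S).
Proof.
by move=> HS S3H loc beta sum0; have [y ly] := loc beta; exact: extend ly sum0.
Qed.

(** If all edges leaving [S'] pointed the same way, the sum of [b] over [S'] would be plus or minus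
    the size of the cut; this is why a strict inequality yields arcs in both directions. *)
Lemma hakimi_in m U S b : S \subset U ->
  (forall u v, m u v = m v u) -> (forall v, m v v = 0%N) ->
  {in S, forall v, (2 %| \sum_(u in U) (m v u)%:Z - b v)%Z} ->
  (forall S', S' \subset S -> `|\sum_(v in S') b v| <= (cutm m U S')%:Z) ->
  exists y, [/\ {in U &, forall u v, (u \in S) || (v \in S) -> (y u v + y v u)%N = m u v},
    {in S, forall v, net y U v = b v} &
    forall S', S' \subset S -> `|\sum_(v in S') b v| < (cutm m U S')%:Z ->
      crossing_arcs y U S'].
Proof.
move=> SU sm irr b2 bcut.
pose mm u v := if [&& (u \in S) || (v \in S), u \in U & v \in U] then m u v else 0%N.
have mmE v u : v \in S -> u \in U -> mm v u = m v u.
  by move=> vS uU; rewrite /mm vS uU (subsetP SU).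
have mm0 v u : v \in S -> u \notin U -> mm v u = 0%N.
  by move=> vS /negPf uU; rewrite /mm uU !andbF.
have cutE S' : S' \subset S -> cutm mm setT S' = cutm m U S'.
  move=> S'S; apply: eq_bigr => v vS'; have vS := subsetP S'S v vS'.
  rewrite (bigID (mem U)) /= [X in (_ + X)%N]big1 ?addn0 => [|u /andP[_]]; last exact: (mm0 _ _ vS).
  apply: eq_big => u; first by rewrite !inE andbT.
  by move=> /andP[_ uU]; apply: mmE.
have [|||S' S'S|y oy ny] := @hakimi T mm S b.
- by move=> u v; rewrite /mm sm orbC [(u \in U) && _]andbC.
- by move=> v; rewrite /mm irr if_same.
- move=> v vS; suff -> : \sum_u (mm v u)%:Z = \sum_(u in U) (m v u)%:Z by apply: b2.
  rewrite (bigID (mem U)) /= [X in _ + X]big1 ?addr0 => [|u]; last by move=> uU; rewrite mm0.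
  by apply: eq_bigr => u uU; rewrite mmE.
- by rewrite cutE // bcut.
have yz u v : mm u v = 0%N -> y u v = 0%N by rewrite -(oy u v) ?inE //; lia.
have nU v : v \in S -> net y U v = b v.
  move=> vS; rewrite -ny // /net (netz_setD _ _ (subsetT U)) [X in _ = _ + X]big1 ?addr0 // => u.
  rewrite !inE andbT => uU.
  have h1 : mm v u = 0%N by apply: mm0.
  have h2 : mm u v = 0%N by rewrite /mm (negPf uU) /= andbF.
  by rewrite !yz.
exists y; split=> //.
  by move=> u v uU vU uvS; rewrite oy ?inE // /mm uvS uU vU.
move=> S' S'S lt; have S'U := subset_trans S'S SU.
have netE : \sum_(v in S') b v = \sum_(v in S') \sum_(u in U :\: S') ((y v u)%:Z - (y u v)%:Z).
  rewrite -(sum_netz (fun u v => (y u v)%:Z)) //; apply: eq_bigr => v vS'.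
  by rewrite -nU // (subsetP S'S).
have cE : (cutm m U S')%:Z = \sum_(v in S') \sum_(u in U :\: S') ((y v u)%:Z + (y u v)%:Z).
  rewrite -cutE // /cutm PoszS; apply: eq_bigr => v vS'; rewrite PoszS.
  rewrite [LHS]big_mkcond [RHS]big_mkcond; apply: eq_bigr => u _; rewrite !inE andbT.
  case: (u \in S') => //=; case: (boolP (u \in U)) => uU; last by rewrite mm0 ?(subsetP S'S).
  by rewrite -(oy v u) ?inE.
have aux (z : T -> T -> nat) :
    (forall a c, a \in S' -> c \in U :\: S' -> z a c = 0%N) \/
    exists a c, [/\ a \in S', c \in U :\: S' & (0 < z a c)%N].
  case: (boolP [exists a in S', [exists c in U :\: S', (0 < z a c)%N]]).
    by move=> /existsP[a /andP[aS /existsP[c /andP[cU zac]]]]; right; exists a, c.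
  move=> /existsPn nex; left=> a c aS cU; have := nex a.
  by rewrite aS => /existsPn/(_ c); rewrite cU -eqn0Ngt => /eqP.
split.
- case: (aux y) => // y0; move: lt; rewrite netE cE.
  suff -> : \sum_(v in S') \sum_(u in U :\: S') ((y v u)%:Z - (y u v)%:Z) =
    - \sum_(v in S') \sum_(u in U :\: S') ((y v u)%:Z + (y u v)%:Z) by lia.
  rewrite -sumzN; apply: eq_bigr => v vS'; rewrite -sumzN; apply: eq_bigr => u uU.
  by have /= := y0 v u vS' uU; lia.
- case: (aux (fun u v => y v u)) => // y0; move: lt; rewrite netE cE.
  suff -> : \sum_(v in S') \sum_(u in U :\: S') ((y v u)%:Z - (y u v)%:Z) =
    \sum_(v in S') \sum_(u in U :\: S') ((y v u)%:Z + (y u v)%:Z) by lia.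
  apply: eq_bigr => v vS'; apply: eq_bigr => u uU.
  by have /= := y0 v u vS' uU; lia.
Qed.

Lemma local_of_net m H S beta b : [disjoint H & S] ->
  (forall u v, m u v = m v u) -> (forall v, m v v = 0%N) ->
  {in S, forall v, (3 %| b v - beta v)%Z} ->
  {in S, forall v, (2 %| \sum_(u in H :|: S) (m v u)%:Z - b v)%Z} ->
  (forall S', S' \subset S -> S' != set0 ->
     `|\sum_(v in S') b v| < (cutm m (H :|: S) S')%:Z) ->
  exists y, local_good m H S beta y.
Proof.
move=> HS sm irr b3 b2 bcut.
have [S' S'S|y [oy ny ay]] := hakimi_in (subsetUr H S) sm irr b2.
  case: (eqVneq S' set0) => [->|/(bcut _ S'S)]; last by lia.
  by rewrite big_set0; lia.
exists y; split=> // [v vS|S' S'S S'0]; first by rewrite ny ?b3.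
exact: ay (bcut _ S'S S'0).
Qed.
End Extension.

(** * Operations that preserve membership in S_3 *)

Section Closure.
Variable T : finType.
Implicit Types (m x y : T -> T -> nat) (X Y : T -> T -> int) (U H S W : {set T}).
Implicit Types (beta : T -> int).

Lemma sumzU1 (a : T) U (F : T -> int) : a \notin U ->
  \sum_(v in a |: U) F v = F a + \sum_(v in U) F v :> int.
Proof. exact: big_setU1. Qed.

Lemma S3on_eq m m' U : {in U &, m =2 m'} -> S3on m U -> S3on m' U.
Proof.
move=> E S3 beta /S3[x [ox sx nx]]; exists x; split=> // u v uU vU.
by rewrite -E // ox.
Qed.

Lemma S3on1 m a : m a a = 0%N -> S3on m [set a].
Proof.
move=> maa beta; rewrite big_set1 => b0; exists (fun _ _ => 0%N); split.
- by move=> u v /set1P-> /set1P->.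
- move=> S; rewrite subset1 => /orP[/eqP->|/eqP->]; last by rewrite eqxx.
  by rewrite eqxx.
- by move=> v /set1P->; rewrite /net /netz big_set1; lia.
Qed.

Lemma strong_le x y U : {in U &, forall u v, x u v <= y u v}%N -> strong x U -> strong y U.
Proof.
move=> le sx S SU S0 SpU; have [a [c [aS cS xac]]] := sx S SU S0 SpU.
exists a, c; split=> //; apply: leq_trans xac (le _ _ _ _); first exact: (subsetP SU).
by move: cS; rewrite inE => /andP[].
Qed.

Lemma sum_netz_delta a c U : a \in U -> c \in U ->
  \sum_(v in U) ((v == a)%:Z - (v == c)%:Z) = 0.
Proof. by move=> aU cU; rewrite sumzB !sum_pred1z ?subrr. Qed.

Lemma S3on_addE m U a c : a \in U -> c \in U -> S3on m U -> S3on (addE m a c) U.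
Proof.
move=> aU cU S3 beta sb.
have [|x [ox sx nx]] := S3 (fun v => beta v - ((v == a)%:Z - (v == c)%:Z)).
  by rewrite sumzB sum_netz_delta // subr0.
exists (fun u v => x u v + ((u == a) && (v == c)))%N; split.
- move=> u v uU vU; rewrite /addE -ox // [(u == c) && _]andbC.
  by move: ((u == a) && _) ((v == a) && _) => A B; lia.
- by apply: strong_le sx => u v _ _; rewrite leq_addr.
move=> v vU; have := nx v vU; rewrite -(netz_delta v aU cU) /net.
rewrite [netz (fun u v => (_ + _)%N%:Z) U v](@eq_netz _ _ (fun u v => (x u v)%:Z + delta a c u v)) //.
rewrite netzD; lia.
Qed.

Lemma sub_weights (U : {set T}) (F : T -> nat) n : (n <= \sum_(u in U) F u)%N ->
  exists2 g : T -> nat, (forall u, g u <= F u)%N & (\sum_(u in U) g u = n)%N.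
Proof.
elim: n => [_|n IH lt]; first by exists (fun _ => 0%N); rewrite ?big1.
have [g gF sg] := IH (ltnW lt).
have [u uU ltu] : exists2 u, u \in U & (g u < F u)%N.
  apply/exists_inP; apply: contraLR lt; rewrite -leqNgt => /exists_inPn nex.
  by rewrite -sg; apply: leq_sum => u uU; rewrite leqNgt nex.
exists (fun v => g v + (v == u))%N => [v|].
  by case: eqP => [->|_]; rewrite ?addn0 // addn1.
by rewrite big_split /= sg (bigD1 u) //= eqxx big1 ?addn1 // => v /andP[_ /negPf->].
Qed.

(* The arc a -> c of the lifted edge is replaced by the path a -> b -> c; [g] distributes the
   out-degrees of b over its other edges, whose multiplicities are [F]. *)
Lemma good_lift m U b a c beta (F g : T -> nat) x :
  (forall u v, m u v = m v u) -> m b b = 0%N ->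
  b \notin U -> a \in U -> c \in U ->
  (forall u, (F u)%:Z = (m b u)%:Z - (u == a)%:Z - (u == c)%:Z) ->
  (forall u, g u <= F u)%N ->
  (3 %| 2 * (\sum_(u in U) g u)%N%:Z - (\sum_(u in U) F u)%N%:Z - beta b)%Z ->
  orients (addE m a c) U x -> strong x U -> (0 < x a c)%N ->
  {in U, forall v, (3 %| net x U v - (beta v - ((F v)%:Z - 2 * (g v)%:Z)))%Z} ->
  exists z, good m (b |: U) beta z.
Proof.
move=> sm mbb bU aU cU FE gF b3 ox sx xac nx.
pose z u v := if u == b then if v == b then 0%N else (g v + (v == c))%N
  else if v == b then (F u - g u + (u == a))%N else (x u v - ((u == a) && (v == c)))%N.
have bN u : u \in U -> (u == b) = false by move=> uU; apply/negbTE; apply: contraNneq bU => <-.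
have zE u v : u \in U -> v \in U -> (z u v)%:Z = (x u v)%:Z - delta a c u v.
  move=> uU vU; rewrite /z /delta !bN //.
  by case: (eqVneq u a) => [->|_] /=; first case: (eqVneq v c) => [->|_] /=; lia.
have zb v : v \in U -> z b v = (g v + (v == c))%N by move=> vU; rewrite /z eqxx bN.
have bz v : v \in U -> z v b = (F v - g v + (v == a))%N by move=> vU; rewrite /z eqxx bN.
have dU : [disjoint [set b] & U] by rewrite disjoints1.
exists z; split.
- move=> u v; rewrite !inE => /orP[/eqP->|uU] /orP[/eqP->|vU].
  + by rewrite /z eqxx mbb.
  + by rewrite zb // bz //; have := gF v; have := FE v; lia.
  + by rewrite zb // bz // sm; have := gF u; have := FE u; lia.
  + have := zE u v uU vU; have := zE v u vU uU; have := ox u v uU vU.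
    rewrite /delta /addE [(u == c) && _]andbC.
    by move: ((u == a) && _) ((v == a) && _) => A B; lia.
- move=> S SU S0 Sp.
  have zbc : (0 < z b c)%N by rewrite zb // eqxx addn1.
  have zab : (0 < z a b)%N by rewrite bz // eqxx addn1.
  case: (boolP ((b \in S) && (c \notin S))) => [/andP[bS cS]|nb].
    by exists b, c; rewrite !inE bS cS cU orbT.
  case: (boolP ((a \in S) && (b \notin S))) => [/andP[aS bS]|na].
    by exists a, b; rewrite !inE aS bS eqxx.
  case: (eqVneq (U :&: S) set0) => [US0|US0].
    case/set0Pn: (S0) => v vS; have := subsetP SU v vS; rewrite !inE => /orP[/eqP vb|vU].
      rewrite vb in vS; rewrite vS /= negbK in nb.
      by have := in_set0 c; rewrite -US0 inE cU nb.
    by have := in_set0 v; rewrite -US0 inE vU vS.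
  case: (eqVneq (U :&: S) U) => [US1|US1].
    have US : U \subset S by rewrite -US1 subsetIr.
    have bS : b \in S by move: na; rewrite (subsetP US a aU) negbK.
    by case/negP: Sp; rewrite eqEsubset SU subUset sub1set bS.
  have [p [q [pI qD xpq]]] := sx (U :&: S) (subsetIl _ _) US0 US1.
  move: pI qD; rewrite !inE => /andP[pU pS] /andP[qN qU]; rewrite qU /= in qN.
  exists p, q; rewrite !inE pS qN qU orbT; split=> //.
  have := zE p q pU qU; rewrite /delta.
  case: (eqVneq p a) => [pa|_]; last by rewrite subr0 => -[->].
  case: (eqVneq q c) => [qc|_]; last by rewrite subr0 => -[->].
  by move: na nb; rewrite -pa pS /= negbK => ->; rewrite -qc qN.
move=> v; rewrite inE => /orP[/set1P->|vU].
  rewrite /net netzU // [netz _ [set b] b](_ : _ = 0) ?add0r; last first.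
    by rewrite /netz big_set1 subrr.
  rewrite /netz; under eq_bigr => u uU do rewrite zb // bz //.
  have -> : \sum_(u in U) ((g u + (u == c))%N%:Z - (F u - g u + (u == a))%N%:Z) =
    \sum_(u in U) ((2 * (g u)%:Z - (F u)%:Z) - ((u == a)%:Z - (u == c)%:Z)).
    by apply: eq_bigr => u _; have := gF u; lia.
  by rewrite sumzB sum_netz_delta // sumzB -mulr_sumr -!PoszS; lia.
rewrite /net netzU // [netz _ [set b] v](_ : _ = (z v b)%:Z - (z b v)%:Z); last first.
  by rewrite /netz big_set1.
rewrite (@eq_netz _ _ (fun u v => (x u v)%:Z + - delta a c u v)).
- rewrite netzD netzN netz_delta // zb // bz //; have := nx v vU; have := gF v.
  by rewrite /net; lia.
- by move=> u uU; rewrite zE.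
- by move=> u uU; rewrite zE.
Qed.

(** The edge [ac] is subdivided by [b], which gives [b] one arc in and one arc out. At least two
    further edges join [b] to [U], and directing 0, 1 or 2 of them away from [b] reaches every
    residue modulo 3. *)
Lemma S3on_lift m U b a c : (forall u v, m u v = m v u) -> m b b = 0%N ->
  b \notin U -> a \in U -> c \in U -> a != c -> (0 < m b a)%N -> (0 < m b c)%N ->
  (4 <= \sum_(u in U) m b u)%N -> S3on (addE m a c) U -> S3on m (b |: U).
Proof.
move=> sm mbb bU aU cU ac mba mbc d4 S3 beta sb.
pose F u := (m b u - (u == a) - (u == c))%N.
have FE u : (F u)%:Z = (m b u)%:Z - (u == a)%:Z - (u == c)%:Z.
  rewrite /F; case: (eqVneq u a) => [->|_]; first by rewrite (negPf ac); lia.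
  by case: eqP => [->|_]; lia.
pose d := (\sum_(u in U) m b u)%N.
have sF : (\sum_(u in U) F u)%N%:Z = d%:Z - 2.
  rewrite PoszS; under eq_bigr do rewrite FE.
  by rewrite !sumzB !sum_pred1z // -PoszS -/d; lia.
(* The out-degree of [b] will be [t + 1], with one arc from the lifted edge; the congruence is
   solved using that 2 is its own inverse modulo 3. *)
have [t [t2 tb]] : exists t : nat, (t <= 2)%N /\ (3 %| 2 * (t%:Z + 1) - d%:Z - beta b)%Z.
  have : exists t : nat, (t <= 2)%N /\ (3 %| t%:Z - ((d%:Z + beta b) * 2 - 1))%Z.
    exists `|(((d%:Z + beta b) * 2 - 1) %% 3)%Z|%N; lia.
  by case=> t [t2 tb]; exists t; split=> //; lia.
have [|g gF sg] := @sub_weights U F t; first by rewrite -/d in d4; lia.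
have [|x [ox sx nx]] := S3 (fun u => beta u - ((F u)%:Z - 2 * (g u)%:Z)).
  move: sb; rewrite sumzU1 //= sumzB sumzB -mulr_sumr -!PoszS sg sF.
  by move: tb => /=; lia.
have xac : (0 < x a c)%N || (0 < x c a)%N.
  by have := ox a c aU cU; rewrite /addE !eqxx /=; lia.
have b3 : (3 %| 2 * (\sum_(u in U) g u)%N%:Z - (\sum_(u in U) F u)%N%:Z - beta b)%Z.
  by rewrite sg sF; lia.
case/orP: xac => [xac|xca]; first exact: (good_lift sm mbb bU aU cU FE gF b3 ox sx xac nx).
have FE' u : (F u)%:Z = (m b u)%:Z - (u == c)%:Z - (u == a)%:Z by rewrite FE; lia.
have ox' : orients (addE m c a) U x.
  by move=> u v uU vU; rewrite ox // /addE -!addnA [((u == a) && _ + _)%N]addnC.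
exact: (good_lift sm mbb bU cU aU FE' gF b3 ox' sx xca nx).
Qed.
End Closure.

(** * Strong modulo 3 orientations and circular flows *)

Section SimpleGraphs.
Variable T : finType.
Implicit Types (x y g : T -> T -> nat) (e : rel T) (U H S W : {set T}).

Definition edgem e : T -> T -> nat := fun u v => e u v.

Lemma strong_connect x : strong x setT -> strongly_connected (fun u v => 0 < x u v)%N.
Proof.
move=> sx a c; set r := (fun _ _ => _).
pose R := [set v | connect r a v].
case: (eqVneq R setT) => [E|RT]; first by have := in_setT c; rewrite -E inE.
have R0 : R != set0 by apply/set0Pn; exists a; rewrite inE connect0.
have [u [v [uR vR xuv]]] := sx R (subsetT _) R0 RT.
move: uR vR; rewrite !inE andbT => uR /negP[].
exact: connect_trans uR (connect1 xuv).
Qed.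

Lemma sum_setTz (F : T -> int) : \sum_(u in setT) F u = \sum_u F u.
Proof. by apply: eq_bigl => u; rewrite inE. Qed.

Lemma orient_edgem e x : simple_graph e -> orients (edgem e) setT x ->
  orientation e (fun u v => 0 < x u v)%N.
Proof.
move=> [se ie] ox; split=> u v; have := ox u v (in_setT _) (in_setT _); rewrite /edgem.
  by case: (e u v) => //; lia.
by move=> + euv; rewrite euv; case: (x u v) => [|[|?]]; case: (x v u) => [|[|?]].
Qed.

Lemma arc_le1 e x u v : orients (edgem e) setT x -> (x u v <= 1)%N.
Proof.
by move=> ox; have := ox u v (in_setT _) (in_setT _); rewrite /edgem; case: (e u v); lia.
Qed.

Lemma S3on_S3 e : simple_graph e -> S3on (edgem e) setT -> S3 e.
Proof.
move=> ge S3e beta sb.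
have [|x [ox sx nx]] := S3e (fun v => (nat_of_ord (beta v))%:Z).
  rewrite sum_setTz -PoszS.
  have : ((\sum_v (nat_of_ord (beta v)))%N%:R : 'Z_3) = 0.
    by rewrite natr_sum -[RHS]sb; apply: eq_bigr => v _; rewrite natr_Zp.
  by move=> /(congr1 val); rewrite /= val_Zp_nat //=; lia.
exists (fun u v => 0 < x u v)%N; split; [exact: orient_edgem|exact: strong_connect|].
move=> v; have := nx v (in_setT v).
have le1 u w := arc_le1 u w ox.
have -> : net x setT v = (outdeg (fun u v => 0 < x u v)%N v)%:Z - (indeg (fun u v => 0 < x u v)%N v)%:Z.
  rewrite /net /netz sum_setTz sumzB -!PoszS /outdeg /indeg -!sum1_card.
  congr (Posz _ - Posz _); rewrite [RHS]big_mkcond; apply: eq_bigr => u _; rewrite inE.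
    by have := le1 v u; case: (x v u) => [|[|?]].
  by have := le1 u v; case: (x u v) => [|[|?]].
move: (outdeg _ _) (indeg _ _) => p q d3; apply/eqP; rewrite subr_eq; apply/eqP.
rewrite -[beta v]natr_Zp -natrD; apply/val_inj => /=; rewrite !val_Zp_nat //=.
by move: d3; lia.
Qed.

Lemma path_flow x a p : path (fun u v => 0 < x u v)%N a p ->
  exists2 g, (forall u v, 0 < g u v -> 0 < x u v)%N &
    forall v, net g setT v = (v == a)%:Z - (v == last a p)%:Z.
Proof.
elim: p a => [|c p IH] a /=.
  by move=> _; exists (fun _ _ => 0%N) => // v; rewrite /net /netz big1 ?subrr.
case/andP=> xac /IH[g gx gn].
exists (fun u v => g u v + ((u == a) && (v == c)))%N.
  by move=> u v; case: (boolP (_ && _)) => [/andP[/eqP-> /eqP->]//|_]; rewrite addn0; apply: gx.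
move=> v; rewrite /net (@eq_netz _ _ (fun u v => (g u v)%:Z + delta a c u v)) //.
by rewrite netzD netz_delta ?inE // -/(net g setT v) gn; lia.
Qed.

(** By strong connectivity each arc closes up to a directed closed walk; one such walk is added for
    every arc. *)
Lemma positive_circulation x : strong x setT ->
  exists g, [/\ (forall u v, 0 < g u v -> 0 < x u v)%N, (forall u v, 0 < x u v -> 0 < g u v)%N &
    forall v, net g setT v = 0].
Proof.
move=> sx.
suff K (s : seq (T * T)) : exists g, [/\ (forall u v, 0 < g u v -> 0 < x u v)%N,
    (forall q, q \in s -> 0 < x q.1 q.2 -> 0 < g q.1 q.2)%N & forall v, net g setT v = 0].
  have [g [g1 g2 g3]] := K (enum {: T * T}); exists g; split=> // u v xuv.
  by apply: (g2 (u, v)) => //; rewrite mem_enum.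
elim: s => [|[a c] s [g [g1 g2 g3]]].
  by exists (fun _ _ => 0%N); split=> // v; rewrite /net /netz big1.
case: (posnP (x a c)) => [x0|xac].
  exists g; split=> // q; rewrite inE => /orP[/eqP->|/g2//] /=; by rewrite x0.
have /connectP[p pth lst] := strong_connect sx c a.
have [h h1 h2] := path_flow pth; rewrite -lst in h2.
exists (fun u v => (g u v + h u v + ((u == a) && (v == c)))%N); split.
- move=> u v; case: (boolP (_ && _)) => [/andP[/eqP-> /eqP->]//|_]; rewrite addn0 addn_gt0.
  by case/orP; [apply: g1|apply: h1].
- move=> q; rewrite inE => /orP[/eqP-> _|qs xq] /=; first by rewrite !eqxx addn1.
  by rewrite !addn_gt0 g2.
move=> v; rewrite /net.
rewrite (@eq_netz _ _ (fun u v => (fun u v => (g u v)%:Z + (h u v)%:Z) u v + delta a c u v)) //.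
by rewrite netzD netzD netz_delta ?inE // -/(net g setT v) -/(net h setT v) g3 h2; lia.
Qed.

(* [hakimi] turns the modulo 3 orientation into an integer flow with values 1 and -2; adding a
   positive circulation g to N times this flow gives absolute values in [N + 1, 2 N - 1]. *)
Lemma flow_of_good e x : simple_graph e -> good (edgem e) setT (fun=> 0) x ->
  flow_index_lt3 e.
Proof.
move=> ge [ox sx nx]; have [se ie] := ge.
pose q v : int := (net x setT v %/ 3)%Z.
have nq v : net x setT v = 3 * q v by have := nx v (in_setT v); rewrite /q; lia.
(* [y] has one third of the net degrees of [x]. The parity condition holds because [q] and [3 q]
   agree modulo 2, the cut condition because [3 q] is already realised by [x]. *)
have [|||S _|y oy ny] := @hakimi T (edgem e) setT q.
- by move=> u v; rewrite /edgem se.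
- by move=> v; rewrite /edgem ie.
- move=> v _; have := @orient_parity _ _ _ (fun v => \sum_u (edgem e v u)%:Z) v ox.
  by rewrite nq subrr => /(_ isT); lia.
- have E : 3 * \sum_(v in S) q v = \sum_(v in S) \sum_(u in setT :\: S) ((x v u)%:Z - (x u v)%:Z).
    rewrite -(sum_netz (fun u v => (x u v)%:Z) (subsetT S)) mulr_sumr.
    by apply: eq_bigr => v _; rewrite -nq.
  have : `|\sum_(v in S) \sum_(u in setT :\: S) ((x v u)%:Z - (x u v)%:Z)| <= (cutm (edgem e) setT S)%:Z.
    rewrite /cutm PoszS; apply: le_trans (ler_norm_sum _ _ _) _; apply: ler_sum => v _.
    rewrite PoszS; apply: le_trans (ler_norm_sum _ _ _) _; apply: ler_sum => u _.
    by rewrite -(ox v u) ?inE //; lia.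
  by rewrite -E; lia.
have [g [g1 g2 g3]] := positive_circulation sx.
pose N := (\sum_u \sum_v g u v).+1.
have gN u v : (g u v < N)%N.
  by rewrite ltnS (bigD1 u) //= (bigD1 v) //= -addnA leq_addr.
exists (3 * N)%N, N.+1; split=> //; first lia.
exists (fun u v => 0 < x u v)%N, (fun u v => N%:Z * (3 * (y u v)%:Z - 2) + (g u v)%:Z).
split; first exact: orient_edgem.
  move=> u v xuv; have := g2 u v xuv; have := gN u v; have := arc_le1 u v oy.
  by case: (y u v) => [|[|?]] //= _; move: (g u v) => G; nia.
move=> v; apply/eqP; rewrite -subr_eq0 big_mkcond [X in _ - X]big_mkcond -sumzB /=; apply/eqP.
(* The part multiplied by N is half of [3 y - x], which is conserved: it equals 1 on arcs where [y]
   agrees with [x] and -2 where [y] is reversed. Doubling avoids the division. *)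
apply: (@mulfI _ (2 : int)) => //; rewrite mulr0.
transitivity (N%:Z * (3 * net y setT v - net x setT v) + 2 * net g setT v); last first.
  by rewrite g3 ny ?inE // nq; ring.
rewrite /net /netz !sum_setTz !mulr_sumr -sumzB !mulr_sumr -sumzD.
apply: eq_bigr => u _ /=.
have g1' a c : x a c = 0%N -> g a c = 0%N.
  by move=> x0; apply/eqP; rewrite -leqn0 leqNgt; apply/negP => /g1; rewrite x0.
have := g1' v u; have := g1' u v.
have : (x u v + x v u = y u v + y v u)%N by rewrite ox ?inE // oy ?inE.
have := arc_le1 u v ox; have := arc_le1 v u ox.
have : (x u v + x v u <= 1)%N by rewrite ox ?inE // /edgem; case: (e u v).
have : (y u v = 0%N \/ y u v = 1%N) /\ (y v u = 0%N \/ y v u = 1%N).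
  by have := arc_le1 u v oy; have := arc_le1 v u oy; lia.
case: (x u v) => [|[|?]]; case: (x v u) => [|[|?]] //= [[->|->] [->|->]] //= _ _ _ _ gu gv;
  by move: gu gv; move: (g u v) (g v u) => r s; lia.
Qed.
End SimpleGraphs.

(** * Dense graphs contain large members of S_3 *)

Section Expansion.
Variable T : finType.
Implicit Types (m x y g : T -> T -> nat) (U H S W K : {set T}).
Implicit Types (b beta : T -> int).

Definition mass m S : nat := (\sum_(v in S) \sum_(u in S) m v u)%N.

Lemma mass_even m S : (forall u v, m u v = m v u) -> (forall v, m v v = 0%N) ->
  mass m S = (2 * (mass m S)./2)%N.
Proof.
move=> sm irr.
pose x u v := if (enum_rank u < enum_rank v)%N then m u v else 0%N.
suff -> : mass m S = (2 * \sum_(v in S) \sum_(u in S) x v u)%N by lia.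
rewrite mul2n -addnn {2}exchange_big -big_split; apply: eq_bigr => v _ /=.
rewrite -big_split; apply: eq_bigr => u _; rewrite /x [m u v]sm /=.
case: ltngtP => //= [_|/val_inj/enum_rank_inj->]; first by rewrite addn0.
by rewrite irr.
Qed.

(** Targets in [0, 5] with the right residues modulo 2 and 3 have a sum divisible by 6. Lowering
    suitably many of them by 6 makes the sum 0 and keeps each at most 6 in absolute value, so the
    total over S is bounded by 6 times the smaller of S and its complement, below the cut. *)
Lemma S3on_expanding m K : (forall u v, m u v = m v u) -> (forall v, m v v = 0%N) ->
  (forall S, S \subset K -> S != set0 -> S != K ->
     6 * minn #|S| #|K :\: S| < cutm m K S)%N -> S3on m K.
Proof.
move=> sm irr exp beta sb.
pose dg v := (\sum_(u in K) m v u)%N.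
(* The Chinese remainder of [dg v] modulo 2 and [beta v] modulo 3. *)
pose c v : nat := `|((3 * (dg v)%:Z - 2 * beta v) %% 6)%Z|%N.
have c3 v : (3 %| (c v)%:Z - beta v)%Z by rewrite /c; lia.
have c2 v : (2 %| (dg v)%:Z - (c v)%:Z)%Z by rewrite /c; lia.
have c5 v : (c v <= 5)%N by rewrite /c; lia.
have s3 : (3 %| \sum_(v in K) (c v)%:Z)%Z.
  have : (3 %| \sum_(v in K) ((c v)%:Z - beta v))%Z.
    by apply: (big_ind (fun z => 3 %| z)%Z) => [|p q|v vS]; [|lia|exact: c3].
  by rewrite sumzB; lia.
have s2 : (2 %| \sum_(v in K) (c v)%:Z)%Z.
  have : (2 %| \sum_(v in K) ((dg v)%:Z - (c v)%:Z))%Z.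
    by apply: (big_ind (fun z => 2 %| z)%Z) => [|p q|v vS]; [|lia|exact: c2].
  by rewrite sumzB -PoszS -/(mass m K) (mass_even K sm irr); lia.
have [|g g1 sg] := @sub_weights T K (fun=> 1%N) ((\sum_(v in K) c v) %/ 6).
  rewrite sum1_card.
  have : (\sum_(v in K) c v <= \sum_(v in K) 5)%N by apply: leq_sum.
  by rewrite sum_nat_const; lia.
pose b v := (c v)%:Z - 6 * (g v)%:Z.
have sbK : \sum_(v in K) b v = 0.
  by rewrite sumzB -mulr_sumr -!PoszS sg; move: s2 s3; rewrite -PoszS; lia.
have b6 S : `|\sum_(v in S) b v| <= 6 * #|S|%:Z.
  apply: le_trans (ler_norm_sum _ _ _) _.
  have -> : 6 * #|S|%:Z = \sum_(v in S) (6 : int) by rewrite sumr_const; lia.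
  by apply: ler_sum => v _; have := g1 v; have := c5 v; rewrite /b; lia.
have bC S : S \subset K -> \sum_(v in S) b v = - \sum_(v in K :\: S) b v.
  move=> SK; have := sbK; rewrite (big_setID S) /= (setIidPr SK).
  by move/eqP; rewrite addr_eq0 => /eqP.
have bcut S : S \subset K -> S != set0 -> S != K -> `|\sum_(v in S) b v| < (cutm m K S)%:Z.
  move=> SK S0 SpK; have := exp S SK S0 SpK; have := b6 S; have := b6 (K :\: S).
  by rewrite (bC S SK); lia.
have [v vK|S SK|x [ox nx ax]] := @hakimi_in T m K K b (subxx K) sm irr.
- by rewrite -PoszS -/(dg v); have := c2 v; rewrite /b; lia.
- case: (eqVneq S set0) => [->|S0]; first by rewrite big_set0.
  case: (eqVneq S K) => [->|SpK]; first by rewrite sbK.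
  by have := bcut S SK S0 SpK; lia.
exists x; split.
- by move=> u v uK vK; apply: ox; rewrite ?uK.
- by move=> S SK S0 SpK; have [] := ax S SK (bcut S SK S0 SpK).
- by move=> v vK; rewrite nx // /b; have := c3 v; lia.
Qed.

(* Entry n bounds twice the number of edges of a simple graph on n vertices without an S_3
   subgraph on more than 23 vertices: complete graphs for n <= 23, and beyond that such a graph
   has a cut of at most [6 * minn i (n - i)] edges by [S3on_expanding]. *)
Fixpoint extremal_table (n : nat) : seq nat :=
  if n is k.+1 then
    let s := extremal_table k in
    rcons s (if (k <= 23)%N then (k * k.-1)%N else
      foldr maxn 0%N [seq (nth 0 s i + nth 0 s (k - i) + 12 * minn i (k - i))%N | i <- iota 1 k.-1])
  else [::].
Definition extremal_bound := extremal_table 74.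

(** 2628 is half of 73 * 72: the masses of two complementary graphs on 73 vertices add up to 73 *
    72, so one of them reaches 2628. *)
Lemma extremal_check :
  [&& nth 0%N extremal_bound 73 < 2628,
   all (fun k => nth 0%N extremal_bound k == k * k.-1)%N (iota 0 24) &
   all (fun k => all (fun i => nth 0%N extremal_bound i + nth 0%N extremal_bound (k - i) +
      12 * minn i (k - i) <= nth 0%N extremal_bound k) (iota 1 k.-1)) (iota 24 50)]%N.
Proof. by vm_compute. Qed.

End Expansion.

(** * Splitting along sparse cuts *)

Section Seeds.
Variable T : finType.
Implicit Types (m x y g : T -> T -> nat) (e : rel T) (U H S W K : {set T}).

Lemma mass_le m K : (forall v, m v v = 0%N) -> (forall u v, m u v <= 1)%N ->
  (mass m K <= #|K| * #|K|.-1)%N.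
Proof.
move=> irr m1; rewrite /mass -sum_nat_const; apply: leq_sum => v vK.
rewrite (bigD1 v) //= irr add0n (cardsD1 v) vK /=.
rewrite -sum1_card big_mkcond [X in (_ <= X)%N]big_mkcond; apply: leq_sum => u _.
by rewrite !inE; case: (u \in K) (u == v) => [] [] //=.
Qed.

Lemma big_subsetD (R : Type) (idx : R) (op : Monoid.com_law idx) (S K : {set T}) (F : T -> R) :
  S \subset K -> \big[op/idx]_(v in K) F v =
    op (\big[op/idx]_(v in S) F v) (\big[op/idx]_(v in K :\: S) F v).
Proof. by move=> SK; rewrite (big_setID S) /= (setIidPr SK). Qed.

Lemma mass_cut m S K : (forall u v, m u v = m v u) -> S \subset K ->
  mass m K = (mass m S + mass m (K :\: S) + 2 * cutm m K S)%N.
Proof.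
move=> sm SK; rewrite {1}/mass (big_subsetD _ _ SK) /=.
under eq_bigr do rewrite (big_subsetD _ _ SK) /=.
rewrite big_split /= -/(mass m S) -/(cutm m K S).
under [X in (_ + _ + X)%N]eq_bigr do rewrite (big_subsetD _ _ SK) /=.
rewrite big_split /= -/(mass m (K :\: S)).
suff -> : (\sum_(i in K :\: S) \sum_(v in S) m i v = cutm m K S)%N by lia.
by rewrite exchange_big; apply: eq_bigr => v _; apply: eq_bigr => u _; rewrite sm.
Qed.

(** Either [K] expands and is itself in S_3, or a sparse cut splits it and, by the recursion of the
    table, one side still exceeds its entry. The descent stops above 23 vertices, where the entries
    are those of complete graphs and cannot be exceeded. *)
Lemma S3on_dense m K : (forall u v, m u v = m v u) -> (forall v, m v v = 0%N) ->
  (forall u v, m u v <= 1)%N -> (#|K| <= 73)%N ->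
  (nth 0%N extremal_bound #|K| < mass m K)%N ->
  exists2 H : {set T}, (24 <= #|H|)%N & S3on m H.
Proof.
move=> sm irr m1; have /and3P[_ /allP small /allP large] := extremal_check.
have [n] := ubnP #|K|; elim: n K => // n IH K; rewrite ltnS => Kn K73 dense.
have [K24|K24] := ltnP #|K| 24.
  have := small #|K|; rewrite mem_iota add0n K24 => /(_ isT)/eqP E.
  by have := mass_le K irr m1; rewrite leqNgt -E dense.
pose bad S := [&& S \subset K, S != set0, S != K & (cutm m K S <= 6 * minn #|S| #|K :\: S|)%N].
case: (boolP [exists S, bad S]) => [/existsP[S /and4P[SK S0 SpK cS]]|nbad]; last first.
  exists K => //; apply: S3on_expanding => // S SK S0 SpK; rewrite ltnNge.
  by move: nbad => /existsPn/(_ S); rewrite /bad SK S0 SpK.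
have cK : #|K| = (#|S| + #|K :\: S|)%N by rewrite -(cardsID S K) (setIidPr SK).
have s0 : (0 < #|S|)%N by rewrite card_gt0.
have d0 : (0 < #|K :\: S|)%N.
  rewrite card_gt0; apply: contra SpK; rewrite setD_eq0 => KS.
  by rewrite eqEsubset SK.
have mE := mass_cut sm SK.
have KI : #|K| \in iota 24 50 by rewrite mem_iota; lia.
have SI : #|S| \in iota 1 #|K|.-1 by rewrite mem_iota; lia.
have := allP (large _ KI) _ SI.
have -> : (#|K| - #|S| = #|K :\: S|)%N by lia.
move=> bd.
have [lt|le] := ltnP (nth 0 extremal_bound #|S|)%N (mass m S); first by apply: IH lt; lia.
by apply: (IH (K :\: S)); lia.
Qed.

Lemma S3on_two_coloured m m' K : (forall u v, m u v = m v u) -> (forall u v, m' u v = m' v u) ->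
  (forall u v, m u v + m' u v = (u != v))%N -> #|K| = 73%N ->
  exists2 H : {set T}, (24 <= #|H|)%N & S3on m H \/ S3on m' H.
Proof.
move=> sm sm' mm K73.
have irr v : m v v = 0%N by have := mm v v; rewrite eqxx /=; lia.
have irr' v : m' v v = 0%N by have := mm v v; rewrite eqxx /=; lia.
have m1 u v : (m u v <= 1)%N by have := mm u v; case: (_ != _); lia.
have m1' u v : (m' u v <= 1)%N by have := mm u v; case: (_ != _); lia.
have : (mass m K + mass m' K = #|K| * 72)%N.
  rewrite /mass -big_split -sum_nat_const; apply: eq_bigr => v vK.
  rewrite -big_split /=; under eq_bigr do rewrite mm.
  have := cardsD1 v K; rewrite vK K73 => E.
  have -> : (\sum_(u in K) (v != u) = #|K :\ v|)%N; last by lia.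
  rewrite -sum1_card big_mkcond [RHS]big_mkcond; apply: eq_bigr => u _.
  by rewrite !inE eq_sym; case: (u \in K) (u == v) => [] [].
rewrite K73 => ms.
have K73' : (#|K| <= 73)%N by rewrite K73.
have [lt|lt] : (nth 0 extremal_bound #|K| < mass m K)%N \/ (nth 0 extremal_bound #|K| < mass m' K)%N.
- have /and3P[+ _ _] := extremal_check; move: ms; rewrite K73.
  by move: (nth 0%N extremal_bound 73) (mass m K) (mass m' K); clear; lia.
- by have [H H24 S3] := S3on_dense sm irr m1 K73' lt; exists H; last left.
- by have [H H24 S3] := S3on_dense sm' irr' m1' K73' lt; exists H; last right.
Qed.
End Seeds.

(** * Choosing out-degrees on sparse cores *)

Definition zsum (T : finType) (f : T -> nat) (A : {set T}) : int := (\sum_(v in A) f v)%N%:Z.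

(** The cycle rank of a connected graph; on a disconnected nonempty set it is only a lower bound,
    but this formula is supermodular whenever [e] is. *)
Definition cycle_rank (T : finType) (e : {set T} -> nat) (A : {set T}) : int :=
  (e A)%:Z - #|A|%:Z + 1.

Section Cores.
Variables (T : finType) (S : {set T}) (e : {set T} -> nat) (ex u : T -> nat).
Hypothesis e_super : forall A B, (e A + e B <= e (A :|: B) + e (A :&: B))%N.
Hypothesis e_small : forall A : {set T}, A != set0 -> (#|A| <= 2)%N -> (e A < #|A|)%N.
Hypothesis e_sparse : forall A : {set T}, A \subset S -> A != set0 ->
  (e A < #|A| + \sum_(v in A) ex v)%N.
Hypothesis u_le2 : forall v, (u v <= 2)%N.

Local Notation X := (zsum ex).
Local Notation U := (zsum u).
Local Notation cyc := (cycle_rank e).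

(* With out-degree [u v + 3 * r v + 1] and degree [4 + ex v] at v, these are the conditions that
   an arc leaves and an arc enters each A. *)
Definition balanced (r : T -> nat) := forall A : {set T}, A \subset S -> A != set0 ->
  (e A < \sum_(v in A) (u v + 3 * r v) + #|A|)%N /\
  (\sum_(v in A) (u v + 3 * r v) + e A < 3 * #|A| + \sum_(v in A) ex v)%N.

Let cyc_super A B : cyc A + cyc B <= cyc (A :|: B) + cyc (A :&: B).
Proof. by have := e_super A B; have := cardsUI A B; rewrite /cycle_rank; lia. Qed.

Let cyc_le (A : {set T}) : A \subset S -> A != set0 -> cyc A <= X A.
Proof. by move=> AS A0; have := e_sparse AS A0; rewrite /cycle_rank /zsum; lia. Qed.

Let cyc_card (A : {set T}) : A != set0 -> 1 <= cyc A -> (3 <= #|A|)%N.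
Proof. by move=> A0; case: (leqP #|A| 2) => // le; have := e_small A0 le; rewrite /cycle_rank; lia. Qed.

Let U_mono (A B : {set T}) : A \subset B -> U B + 2 * #|A|%:Z <= U A + 2 * #|B|%:Z.
Proof.
move=> AB; rewrite /zsum -(cardsID A B) (big_setID A) /= (setIidPr AB).
have : (\sum_(v in B :\: A) u v <= \sum_(v in B :\: A) 2)%N by apply: leq_sum.
by rewrite sum_nat_const; lia.
Qed.

Let U_ge (A : {set T}) v : v \in A -> (u v)%:Z <= U A.
Proof. by move=> vA; rewrite /zsum (bigD1 v) //= lez_nat leq_addr. Qed.

Let X_ge (A : {set T}) v : v \in A -> (ex v)%:Z <= X A.
Proof. by move=> vA; rewrite /zsum (bigD1 v) //= lez_nat leq_addr. Qed.

Let set_n0 (A : {set T}) v : v \in A -> A != set0.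
Proof. by move=> vA; apply/set0Pn; exists v. Qed.

(** For [r = 0] the condition on leaving arcs reads [cyc A <= U A], so the sets with [U A < cyc A]
    are exactly the violated ones. The condition on entering arcs then follows from sparsity and
    [u <= 2]. *)
Lemma balanced0 : (forall A : {set T}, A \subset S -> A != set0 -> cyc A <= U A) -> balanced (fun=> 0%N).
Proof.
move=> viol A AS A0; under eq_bigr do rewrite muln0 addn0.
have := viol A AS A0; have := cyc_le AS A0; have := U_mono (sub0set A).
by rewrite /zsum big_set0 cards0 /cycle_rank; lia.
Qed.

(** A single raise by 3 repairs any violated set, as its rank is at most 3; hence [R] only has to
    meet all of them. The last hypothesis is the condition on entering arcs, the price of
    raising. *)
Lemma balanced_raise (R : {set T}) : (forall A : {set T}, A \subset S -> A != set0 -> cyc A <= 3) ->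
  (forall A : {set T}, A \subset S -> A != set0 -> U A < cyc A -> exists2 z, z \in R & z \in A) ->
  (forall A : {set T}, A \subset S -> R :&: A != set0 ->
     U A + 3 * #|R :&: A|%:Z <= 2 * #|A|%:Z + X A - cyc A) ->
  balanced (fun v => (v \in R)%N).
Proof.
move=> c3 hit up A AS A0.
have -> : (\sum_(v in A) (u v + 3 * (v \in R)) = \sum_(v in A) u v + 3 * #|R :&: A|)%N.
  rewrite big_split /= -big_distrr -sum1_card; congr (_ + 3 * _)%N.
  rewrite big_mkcond [RHS]big_mkcond; apply: eq_bigr => v _.
  by rewrite inE; case: (v \in A) (v \in R) => [] [].
case: (eqVneq (R :&: A) set0) => [RA|RA].
  have cU : cyc A <= U A.
    rewrite leNgt; apply/negP => /(hit A AS A0)[z zR zA].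
    by have := in_set0 z; rewrite -RA inE zR zA.
  have := cyc_le AS A0; have := U_mono (sub0set A).
  by move: cU; rewrite RA cards0 /zsum big_set0 /cycle_rank /zsum; lia.
have := up A AS RA; have := c3 A AS A0; have : (0 < #|R :&: A|)%N by rewrite card_gt0.
by rewrite /cycle_rank /zsum; lia.
Qed.

Lemma balanced_raise1 z : z \in S -> (forall A : {set T}, A \subset S -> A != set0 -> cyc A <= 3) ->
  (forall A : {set T}, A \subset S -> A != set0 -> U A < cyc A -> z \in A) ->
  (forall A : {set T}, A \subset S -> z \in A -> U A + 3 <= 2 * #|A|%:Z + X A - cyc A) ->
  exists r, balanced r.
Proof.
move=> zS c3 hit up; exists (fun v => (v \in [set z])%N); apply: balanced_raise => //.
  by move=> A AS A0 vA; exists z; rewrite ?inE ?(hit A).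
move=> A AS; rewrite setIC; case/set0Pn => w; rewrite !inE => /andP[wA /eqP wz].
have zA : z \in A by rewrite -wz.
have -> : A :&: [set z] = [set z] by apply/setIidPr; rewrite sub1set.
by rewrite cards1; have := up A AS zA; lia.
Qed.

Let X_mono (A B : {set T}) : A \subset B -> X A <= X B.
Proof.
by move=> AB; rewrite /zsum [in X in _ <= X](big_setID A) /= (setIidPr AB); clear; lia.
Qed.

(** An intersection of positive rank contains a cycle and so has at least three vertices, on which
    [u] sums to at most [U F]. This pushes [U A] well below its maximum [2 * #|A|]. *)
Let U_core (F A : {set T}) : F :&: A != set0 ->
  cyc (F :&: A) <= 0 \/ 6 + U A <= 2 * #|A|%:Z + U F.
Proof.
move=> I0; case: (leP (cyc (F :&: A)) 0) => [|c1]; [by left|right].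
have := cyc_card I0 c1; have := U_mono (subsetIr F A).
have : U (F :&: A) <= U F by rewrite /zsum [in X in _ <= X](big_setID A) /=; clear; lia.
by clear; lia.
Qed.

Let U_del z (A : {set T}) : z \in A -> U A + 2 <= 2 * #|A|%:Z + (u z)%:Z.
Proof.
move=> zA; have := U_mono (_ : [set z] \subset A); rewrite sub1set => /(_ zA).
by rewrite cards1 /zsum big_set1; clear; lia.
Qed.

Let U_ge0 A : 0 <= U A. Proof. by []. Qed.

(** A set avoiding [z] has no excess, hence rank at most 0, and is not violated. So raising [z]
    repairs everything; comparing a set through [z] with one violated set [F] by supermodularity
    shows that it keeps an entering arc. *)
Lemma balanced_single z : z \in S -> X S <= 2 -> X S = (ex z)%:Z -> exists r, balanced r.
Proof.
move=> zS XS Xz.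
have X0 (A : {set T}) : A \subset S -> z \notin A -> X A = 0.
  move=> AS zA; have := Xz; rewrite /zsum (big_setID A) /= (setIidPr AS).
  by rewrite [in X in (_ + X)%N](bigD1 z) ?inE ?zA //=; clear; lia.
case: (boolP [exists A : {set T}, [&& A \subset S, A != set0 & U A < cyc A]]); last first.
  move=> /existsPn nv; exists (fun=> 0%N); apply: balanced0 => A AS A0.
  by have := nv A; rewrite AS A0 /= -leNgt.
case/existsP=> F /and3P[FS F0 vF].
have hit (A : {set T}) : A \subset S -> A != set0 -> U A < cyc A -> z \in A.
  move=> AS A0 vA; apply: contraLR vA => /(X0 A AS) XA; rewrite -leNgt.
  by have := cyc_le AS A0; rewrite XA; have := U_ge0 A; clear; lia.
apply: (balanced_raise1 zS) => //.
  by move=> A AS A0; move: XS; have := cyc_le AS A0; have := X_mono AS; clear; lia.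
move=> A AS zA; have zF := hit F FS F0 vF.
have I0 : F :&: A != set0 by apply: (@set_n0 _ z); rewrite inE zF.
have A0 := set_n0 zA; have XA : X A = X S.
  by move: Xz; have := X_mono AS; have := X_ge zA; clear; lia.
have US : F :|: A \subset S by rewrite subUset FS.
have U0 : F :|: A != set0 by apply: (@set_n0 _ z); rewrite inE zF.
rewrite XA; move: XS vF.
have := cyc_super F A; have := cyc_le US U0; have := X_mono US.
have := cyc_le FS F0; have := X_mono FS; have := cyc_le AS A0; rewrite XA.
have := U_core I0; have := U_del zA; have := U_ge zF; have := U_ge0 F.
move: (cyc (F :|: A)) (cyc (F :&: A)) (cyc F) (cyc A) (X F) (X (F :|: A)) (X S) (U A) (U F).
by move: #|A| (u z); clear; lia.
Qed.

(** * Two vertices of excess one *)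

Section Double.
Variables z1 z2 : T.
Hypotheses (z1S : z1 \in S) (z2S : z2 \in S) (z12 : z1 != z2).
Hypothesis XE : forall A : {set T}, A \subset S -> X A = (z1 \in A)%:Z + (z2 \in A)%:Z.

Let viol (A : {set T}) := [&& A \subset S, A != set0 & U A < cyc A].
(** The only obstruction to raising [z] alone when [u z = 0] and all violated sets contain [z]: here
    [u] equals 2 on all of [A] except [z]. *)
Let lopsided z z' (A : {set T}) :=
  [&& A \subset S, z \in A, z' \notin A, cyc A == 1 & U A == 2 * #|A|%:Z - 2].

Let cyc_ub (A : {set T}) : A \subset S -> A != set0 ->
  cyc A <= (z1 \in A)%:Z + (z2 \in A)%:Z.
Proof. by move=> AS /(cyc_le AS); rewrite XE. Qed.

Let cyc2 (A : {set T}) : A \subset S -> A != set0 -> cyc A <= 2.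
Proof. by move=> AS /(cyc_ub AS); move: (z1 \in A) (z2 \in A); clear; lia. Qed.

Let violP F : viol F -> [/\ F \subset S, F != set0 & U F < cyc F].
Proof. by case/and3P. Qed.

Let U_top F : viol F -> U F <= 1.
Proof. by case/violP => FS F0; have := cyc2 FS F0; clear; lia. Qed.

(* Two sets that meet and whose cycle ranks exceed the rank 2 of the whole share a cycle. *)
Let meet_rank (F A : {set T}) : F \subset S -> A \subset S -> F :&: A != set0 ->
  cyc F + cyc A - 2 <= cyc (F :&: A).
Proof.
move=> FS AS I0; have US : F :|: A \subset S by rewrite subUset FS.
have U0 : F :|: A != set0.
  by case/set0Pn: I0 => v; rewrite inE => /andP[vF _]; apply: (@set_n0 _ v); rewrite inE vF.
by have := cyc_super F A; have := cyc2 US U0; clear; lia.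
Qed.

Let meet_U (F A : {set T}) : viol F -> A \subset S -> F :&: A != set0 ->
  3 <= cyc F + cyc A -> 5 + U A <= 2 * #|A|%:Z.
Proof.
move=> vF AS I0 c3; have [FS F0 _] := violP vF; move: c3.
have := meet_rank FS AS I0; have := U_core I0; have := U_top vF; clear; lia.
Qed.

Let raise_one z z' F : (z, z') = (z1, z2) \/ (z, z') = (z2, z1) -> viol F ->
  (forall A, viol A -> z \in A) -> u z = 0%N -> ~~ [exists A, lopsided z z' A] ->
  exists r, balanced r.
Proof.
move=> zz vF hit uz /existsPn nl.
have zS : z \in S by case: zz => -[-> _].
have XA (A : {set T}) : A \subset S -> X A = (z \in A)%:Z + (z' \in A)%:Z.
  by move=> AS; rewrite XE //; case: zz => -[-> ->] //; rewrite addrC.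
apply: (balanced_raise1 zS) => [A AS A0|A AS A0 vA|A AS zA].
- by have := cyc2 AS A0; clear; lia.
- by apply: hit; rewrite /viol AS A0.
have A0 := set_n0 zA; have := U_del zA; rewrite uz XA // zA.
have := cyc_le AS A0; rewrite XA // zA.
have := nl A; rewrite /lopsided AS zA /=.
have I0 : F :&: A != set0 by apply: (@set_n0 _ z); rewrite inE (hit F vF).
have [_ _] := violP vF; have := U_ge0 F; have := meet_U vF AS I0.
by case: (z' \in A) => /=; move: (cyc F) (cyc A) (U F) (U A) #|A|; clear; lia.
Qed.

(** A violated set that misses one of the two vertices has rank 1, contains the other one, and has
    [u = 0] throughout. Sets of positive rank that would block the raising share a cycle with [F1],
    [F2] or their union, and so contain three vertices with [u = 0]. *)
Let raise_both F1 F2 : viol F1 -> z1 \notin F1 -> viol F2 -> z2 \notin F2 ->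
  exists r, balanced r.
Proof.
move=> v1 n1 v2 n2; exists (fun v => (v \in [set z1; z2])%N).
have [S1 F10 l1] := violP v1; have [S2 F20 l2] := violP v2.
have : [/\ z2 \in F1, z1 \in F2, U F1 = 0 & U F2 = 0] /\ cyc F1 = 1 /\ cyc F2 = 1.
  move: l1 l2; have := cyc_ub S1 F10; have := cyc_ub S2 F20; rewrite (negPf n1) (negPf n2).
  have := U_ge0 F1; have := U_ge0 F2.
  case: (z2 \in F1); case: (z1 \in F2) => /=; move: (U F1) (U F2) (cyc F1) (cyc F2); clear;
    move=> a b c d *; try lia.
  by do !split; lia.
move=> [[z2F z1F U1 U2] [c1 c2]].
have uz1 : u z1 = 0%N by have := U_ge z1F; rewrite U2; clear; lia.
have uz2 : u z2 = 0%N by have := U_ge z2F; rewrite U1; clear; lia.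
clear l1 l2 v1 v2.
apply: balanced_raise => [A AS A0|A AS A0 vA|A AS RA].
- by have := cyc2 AS A0; clear; lia.
- move: vA; have := cyc_ub AS A0; have := U_ge0 A.
  case z1A: (z1 \in A); first by exists z1; rewrite ?inE ?eqxx.
  case z2A: (z2 \in A); first by exists z2; rewrite ?inE ?eqxx ?orbT.
  by rewrite /=; clear; lia.
have A0 : A != set0 by case/set0Pn: RA => v; rewrite inE => /andP[_ vA]; exact: set_n0 vA.
have cardR : #|[set z1; z2] :&: A|%:Z = (z1 \in A)%:Z + (z2 \in A)%:Z.
  rewrite -sum1_card big_mkcond /= (bigD1 z1) //= (bigD1 z2) 1?eq_sym //= big1 => [|v].
    by rewrite !inE !eqxx orbT /= addn0 PoszD; case: (z1 \in A) (z2 \in A) => [] [].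
  by rewrite !inE => /andP[/negPf-> /negPf->].
have RA' : (z1 \in A) || (z2 \in A).
  by move: RA; rewrite -card_gt0; move: cardR; case: (z1 \in A) (z2 \in A) => [] []; clear; lia.
rewrite cardR XE //; have := cyc_ub AS A0.
case z1A: (z1 \in A); last first.
  have z2A : z2 \in A by move: RA'; rewrite z1A.
  rewrite z2A; have I1 : F1 :&: A != set0 by apply: (@set_n0 _ z2); rewrite inE z2F.
  have := U_core I1; rewrite U1; have := cyc_super F1 A; rewrite c1.
  have US : F1 :|: A \subset S by rewrite subUset S1.
  have U0 : F1 :|: A != set0 by apply: (@set_n0 _ z2); rewrite inE z2F.
  have := cyc_ub US U0; rewrite !inE (negPf n1) z1A z2F.
  have := U_del z2A; rewrite uz2 /=.
  by move: (cyc (F1 :&: A)) (cyc (F1 :|: A)) (cyc A) (U A) #|A|; clear; lia.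
have I2 : F2 :&: A != set0 by apply: (@set_n0 _ z1); rewrite inE z1F.
have := U_core I2; rewrite U2; have := cyc_super F2 A; rewrite c2.
have US : F2 :|: A \subset S by rewrite subUset S2.
have U0 : F2 :|: A != set0 by apply: (@set_n0 _ z1); rewrite inE z1F.
have := cyc_ub US U0; rewrite !inE (negPf n2) z1F; have := U_del z1A; rewrite uz1 /=.
case z2A: (z2 \in A) => /=; last first.
  by move: (cyc (F2 :&: A)) (cyc (F2 :|: A)) (cyc A) (U A) #|A|; clear; lia.
have I1 : F1 :&: A != set0 by apply: (@set_n0 _ z2); rewrite inE z2F.
have U12 : U A + 4 <= 2 * #|A|%:Z.
  have : [set z1; z2] \subset A by rewrite subUset !sub1set z1A.
  move/U_mono; rewrite cards2 z12 /zsum big_setU1 ?inE //= big_set1 uz1 uz2; clear; lia.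
have U4 : cyc (F2 :&: A) <= 0 \/ 8 + U A <= 2 * #|A|%:Z.
  case: (leP (cyc (F2 :&: A)) 0) => [|ci]; [by left|right].
  have : z2 |: (F2 :&: A) \subset A by rewrite subUset sub1set z2A subsetIr.
  have zn : z2 \notin F2 :&: A by rewrite inE (negPf n2).
  have : U (F2 :&: A) <= U F2 by rewrite /zsum [in X in _ <= X](big_setID A) /=; clear; lia.
  move=> UI /U_mono; move: UI; rewrite cardsU1 zn U2 /zsum big_setU1 //= uz2.
  by have := cyc_card I2 ci; clear; lia.
have U1' := U_core I1; rewrite U1 in U1'.
have three : 1 <= cyc A -> 1 <= cyc (F1 :&: A) \/ 1 <= cyc (F2 :&: A) \/ 6 + U A <= 2 * #|A|%:Z.
  move=> cA; case: (eqVneq (F1 :&: F2) set0) => [F12|F12].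
    case: (leP 1 (cyc (F2 :&: A))) => [|cI]; [by right; left|left].
    have J1 : F1 :&: (F2 :|: A) = F1 :&: A by rewrite setIUr F12 set0U.
    have := meet_rank S1 US; rewrite J1 => /(_ I1).
    by move: cI cA; have := cyc_super F2 A; rewrite c1 c2; clear; lia.
  right; right.
  have G0 : (F1 :|: F2) :&: A != set0 by apply: (@set_n0 _ z1); rewrite !inE z1F z1A orbT.
  have GS : F1 :|: F2 \subset S by rewrite subUset S1.
  have UG : U (F1 :|: F2) <= U F1 + U F2.
    rewrite /zsum -PoszD lez_nat (big_setID F1) /= setUK leq_add2l setDUl setDv set0U.
    by rewrite [X in (_ <= X)%N](big_setID F1) /= leq_addl.
  have c12 := cyc_ub (subset_trans (subsetIl F1 F2) S1) F12.
  rewrite !inE (negPf n1) (negPf n2) andbF /= in c12.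
  move: UG c12 cA; rewrite U1 U2; have := U_core G0; have := meet_rank GS AS G0.
  by have := cyc_super F1 F2; rewrite c1 c2; clear; lia.
move: U12 U4 U1' three.
by move: (cyc (F1 :&: A)) (cyc (F2 :&: A)) (cyc (F2 :|: A)) (cyc A) (U A) #|A|; clear; lia.
Qed.

(** If each of the two vertices is missed by some violated set, both are raised. Otherwise some [z]
    lies in all violated sets, and raising [z] or the other vertex [z'] suffices. *)
Lemma balanced_double : exists r, balanced r.
Proof.
case: (boolP [exists A, viol A]) => [/existsP[F vF]|/existsPn nv]; last first.
  by exists (fun=> 0%N); apply: balanced0 => A AS A0; have := nv A; rewrite /viol AS A0 -leNgt.
have main z z' : (z, z') = (z1, z2) \/ (z, z') = (z2, z1) -> (forall A, viol A -> z \in A) ->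
    exists r, balanced r.
  move=> zz hit.
  have zz' : (z', z) = (z1, z2) \/ (z', z) = (z2, z1) by case: zz => -[-> ->]; [right|left].
  have nzz : z != z' by case: zz => -[-> ->] //; rewrite eq_sym.
  have ub (A : {set T}) : A \subset S -> A != set0 -> cyc A <= (z \in A)%:Z + (z' \in A)%:Z.
    by move=> AS /(cyc_ub AS); case: zz => -[-> ->] //; rewrite addrC.
  suff : [/\ (forall A, viol A -> z' \in A), u z' = 0%N & ~~ [exists A, lopsided z' z A]] \/
      (u z = 0%N /\ ~~ [exists A, lopsided z z' A]).
    case=> [[hit' u0 nl]|[u0 nl]]; first exact: raise_one zz' vF hit' u0 nl.
    exact: raise_one zz vF hit u0 nl.
  (* If [u z] is positive, every violated set has [U] equal to 1 and rank 2; it then contains [z'],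
     with [u z' = 0], and [z'] is raised. *)
  case: (posnP (u z)) => [uz|uz]; last first.
    have big (E : {set T}) : viol E -> [/\ z' \in E, u z' = 0%N & cyc E = 2].
      move=> vE; have zE := hit E vE; have [ES E0 lt] := violP vE; move: lt uz.
      have := U_top vE; have := U_ge zE; have := ub E ES E0; rewrite zE.
      case z'E: (z' \in E); last by clear; lia.
      have : (u z)%:Z + (u z')%:Z <= U E.
        by rewrite /zsum (bigD1 z) //= (bigD1 z') /= ?z'E 1?eq_sym //; clear; lia.
      by move: (u z') (cyc E) (U E) (u z); clear; move=> a b c d *; split=> //; lia.
    left; have [z'F uz' c2] := big F vF; split=> // [A vA|]; first by have [] := big A vA.
    apply/existsPn => A; apply/negP => /and5P[AS zA z'A /eqP cA /eqP UA].
    have I0 : F :&: A != set0 by apply: (@set_n0 _ z'); rewrite inE z'F.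
    have [FS F0 _] := violP vF; move: UA.
    by have := meet_rank FS AS I0; have := U_core I0; have := U_top vF; rewrite c2 cA; clear; lia.
  case: (boolP [exists A, lopsided z z' A]) => [/existsP[A lA]|nl]; last by right.
  left.
  (* A lopsided set for [z] forces each violated set to contain [z'] and to have [u = 0]; then [z']
     can be raised unless it has a lopsided set too. *)
  have opp y y' (B E : {set T}) : (forall D : {set T}, D \subset S -> D != set0 ->
        cyc D <= (y \in D)%:Z + (y' \in D)%:Z) -> lopsided y y' B -> viol E -> y \in E ->
      [/\ y' \in E, U E = 0, cyc E = 1, cyc (E :&: B) <= 0 & cyc (E :|: B) = 2].
    move=> ub' /and5P[BS yB y'B /eqP cB /eqP UB] vE yE; have [ES E0 lt] := violP vE.
    have I0 : E :&: B != set0 by apply: (@set_n0 _ y); rewrite inE yE.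
    have US : E :|: B \subset S by rewrite subUset ES.
    have U0 : E :|: B != set0 by apply: (@set_n0 _ y); rewrite inE yE.
    move: lt UB; have := U_core I0; have := cyc_super E B; have := ub' _ US U0.
    rewrite !inE yE (negPf y'B) cB; have := U_top vE; have := U_ge0 E.
    case: (y' \in E); move: (cyc E) (cyc (E :|: B)) (cyc (E :&: B)) (U E) (U B) #|B|; clear => /=;
      move=> a b c d f g *; first by split=> //; lia.
    by exfalso; lia.
  have ubr (D : {set T}) : D \subset S -> D != set0 -> cyc D <= (z' \in D)%:Z + (z \in D)%:Z.
    by move=> DS /(ub D DS); rewrite addrC.
  have zF := hit F vF; have [FS F0 _] := violP vF.
  have [z'F UF cF cFA cFA2] := opp _ _ _ _ ub lA vF zF.
  split=> [E vE||]; first by have [] := opp _ _ _ _ ub lA vE (hit E vE).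
    by have := U_ge z'F; rewrite UF; clear; lia.
  apply/existsPn => A'; apply/negP => lA'.
  have [_ _ _ cFA' _] := opp _ _ _ _ ubr lA' vF z'F.
  case/and5P: lA => AS zA z'A /eqP cA /eqP UA; case/and5P: lA' => AS' z'A' zA' /eqP cA' /eqP UA'.
  (* Opposite lopsided sets are incompatible. Uncrossing gives a set of positive rank, hence of
     three vertices, inside [F], where [u = 0], and covered by [A] and [A']. But [U] is within 2 of
     its maximum on each of these, which leaves room for one such vertex in each. *)
  pose B := (F :|: A) :&: A'.
  have GS : F :|: A \subset S by rewrite subUset FS.
  have B0 : B != set0 by apply: (@set_n0 _ z'); rewrite !inE z'F z'A'.
  have BA' : B \subset A' by apply: subsetIr.
  have cB : 1 <= cyc B by rewrite /B; have := meet_rank GS AS' B0; rewrite cFA2 cA'; clear; lia.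
  have BA : B :&: A = A :&: A'.
    by apply/setP => v; rewrite !inE; case: (v \in F) (v \in A) (v \in A') => [] [] [].
  have AA0 : A :&: A' != set0.
    apply: contraTneq cB => AA; have -> : B = F :&: A' by rewrite /B setIUl AA setU0.
    by move: cFA'; clear; lia.
  have cAA := ub _ (subset_trans (subsetIl A A') AS) AA0.
  rewrite !inE (negPf z'A) (negPf zA') andbF /= in cAA.
  have cBA : 2 <= cyc (B :|: A).
    by move: cB cAA; have := cyc_super B A; rewrite BA cA; clear; lia.
  have BS : B :|: A \subset S by rewrite subUset AS (subset_trans BA' AS').
  have C0 : (B :|: A) :&: F != set0 by apply: (@set_n0 _ z); rewrite !inE zA zF orbT.
  have cC : 1 <= cyc ((B :|: A) :&: F).
    by move: cBA; have := meet_rank BS FS C0; rewrite cF; clear; lia.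
  have C3 := cyc_card C0 cC; set C := _ :&: F in C0 cC C3.
  have UC (D : {set T}) : D \subset F -> U D = 0.
    move=> DF; have : U D <= U F by rewrite /zsum -(setIidPr DF) [in X in _ <= X](big_setID D) /= (setIidPr DF); clear; lia.
    by rewrite UF; have := U_ge0 D; clear; lia.
  have CF : C \subset F by apply: subsetIr.
  have CA := U_mono (subsetIr C A); have CA' := U_mono (subsetIr C A').
  rewrite (UC _ (subset_trans (subsetIl _ _) CF)) UA in CA.
  rewrite (UC _ (subset_trans (subsetIl _ _) CF)) UA' in CA'.
  have : (#|C| <= #|C :&: A| + #|C :&: A'|)%N.
    rewrite (leq_trans _ (leq_card_setU _ _)) // subset_leq_card // -setIUr subsetI subxx /=.
    by apply: subset_trans (subsetIl _ _) _; rewrite subUset subsetUl (subset_trans BA') ?subsetUr.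
  by move: C3 CA CA'; clear; lia.
case: (boolP [exists A, viol A && (z1 \notin A)]) => [/existsP[F1 /andP[v1 n1]]|/existsPn a1].
  case: (boolP [exists A, viol A && (z2 \notin A)]) => [/existsP[F2 /andP[v2 n2]]|/existsPn a2].
    exact: raise_both v1 n1 v2 n2.
  apply: (main z2 z1); [by right|move=> A vA]; by have := a2 A; rewrite vA negbK.
by apply: (main z1 z2); [left|move=> A vA; have := a1 A; rewrite vA negbK].
Qed.
End Double.
End Cores.

(** * Cores of cycle rank three *)

Section CoreSearch.

Fixpoint all_masks (n : nat) : seq bitseq :=
  if n is k.+1 then map (cons false) (all_masks k) ++ map (cons true) (all_masks k)
  else [:: [::]].

Fixpoint all_words (n : nat) : seq (seq nat) :=
  if n is k.+1 then flatten [seq map (cons i) (all_words k) | i <- [:: 0; 1; 2]]%N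
  else [:: [::]].

(* Unlike [all] and [has], these stop early under call-by-value evaluation. *)
Fixpoint lazy_all (A : Type) (a : pred A) (s : seq A) : bool :=
  if s is x :: s' then if a x then lazy_all a s' else false else true.

Fixpoint lazy_has (A : Type) (a : pred A) (s : seq A) : bool :=
  if s is x :: s' then if a x then true else lazy_has a s' else false.

Lemma lazy_allE (A : Type) (a : pred A) s : lazy_all a s = all a s.
Proof. by elim: s => //= x s ->; case: (a x). Qed.

Lemma lazy_hasE (A : Type) (a : pred A) s : lazy_has a s = has a s.
Proof. by elim: s => //= x s ->; case: (a x). Qed.

(* Each vertex carries its excess and its adjacencies to the later vertices of the list. *)
Definition wgraph := seq (nat * bitseq).

Fixpoint wedges (mk : bitseq) (g : wgraph) : nat :=
  match mk, g with
  | b :: mk', p :: g' => ((if b then count id (mask mk' p.2) else 0) + wedges mk' g')%N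
  | _, _ => 0%N
  end.

Definition wexcess (mk : bitseq) (g : wgraph) : nat := sumn (mask mk (unzip1 g)).

Definition sparse_mask (g : wgraph) (mk : bitseq) : bool :=
  ((wedges mk g).+1 <= count id mk + wexcess mk g)%N.

(** The new vertex is put in front, with excess at least that of the next one. Only subsets
    containing it are tested for sparsity; the others were tested earlier. *)
Definition wgraph_step (K k : nat) (g : wgraph) : seq wgraph :=
  flatten [seq [seq (i, row) :: g | row <- all_masks k &
      lazy_all (fun mk => sparse_mask ((i, row) :: g) (true :: mk)) (all_masks k)] |
    i <- iota 0 K.+1 & (head 0 (unzip1 g) <= i) && (i + sumn (unzip1 g) <= K)]%N.
Arguments wgraph_step : simpl never.

Fixpoint wgraphs (K n : nat) : seq wgraph :=
  if n is k.+1 then flatten [seq wgraph_step K k g | g <- wgraphs K k] else [:: [::]].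

Definition tight (K : nat) (g : wgraph) : bool :=
  ((sumn (unzip1 g) == K) && ((wedges (nseq (size g) true) g).+1 == size g + K))%N.

(** Symmetry breaking: vertices of equal excess can be listed by decreasing residue. *)
Fixpoint word_sorted (g : wgraph) (us : seq nat) : bool :=
  match g, us with
  | p :: ((q :: _) as g'), u :: ((u' :: _) as us') =>
      ((p.1 == q.1) ==> (u' <= u)%N) && word_sorted g' us'
  | _, _ => true
  end.

Definition lift_word (us : seq nat) (r : bitseq) : seq nat :=
  [seq (p.1 + 3 * nat_of_bool p.2)%N | p <- zip us r].

Definition mask_data (g : wgraph) : seq (bitseq * (nat * nat)) :=
  [seq (mk, ((wedges mk g).+1, (3 * count id mk + wexcess mk g - (wedges mk g).+1)%N)) |
     mk <- all_masks (size g) & has id mk].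

Definition word_ok (d : seq (bitseq * (nat * nat))) (vs : seq nat) : bool :=
  lazy_all (fun p => let t := sumn (mask p.1 vs) in
    if (p.2.1 <= t + count id p.1)%N then (t <= p.2.2)%N else false) d.

Definition check_graph (g : wgraph) : bool :=
  let d := mask_data g in
  let rs := [seq r <- all_masks (size g) | all2 (fun (b : bool) k => b ==> (0 < k)%N) r (unzip1 g)] in
  all (fun us => if word_sorted g us then lazy_has (fun r => word_ok d (lift_word us r)) rs else true)
    (all_words (size g)).

Definition check_cores (K n : nat) : bool := all (fun g => if tight K g then check_graph g else true) (wgraphs K n).

(** Excess 3 forces [#|S| + 2] edges, impossible in a simple graph on fewer than four vertices,
    while [#|S| + 3 <= 8] allows at most five. *)
Lemma check_cores3 : check_cores 3 4 && check_cores 3 5.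
Proof. by vm_compute. Qed.

Lemma mem_all_masks n (mk : bitseq) : size mk = n -> mk \in all_masks n.
Proof.
elim: n mk => [|n IH] [|b mk] //= [sz]; rewrite mem_cat.
by case: b; rewrite map_f ?IH ?orbT.
Qed.

Lemma size_all_masks n (mk : bitseq) : mk \in all_masks n -> size mk = n.
Proof.
elim: n mk => [|n IH] mk /=; first by rewrite inE => /eqP->.
by rewrite mem_cat => /orP[] /mapP[mk' /IH <- ->].
Qed.

Lemma mem_all_words n (us : seq nat) : size us = n -> all (fun i => i <= 2)%N us ->
  us \in all_words n.
Proof.
elim: n us => [|n IH] [|i us] //= [sz] /andP[i2 us2].
have := IH us sz us2; case: i i2 => [|[|[|//]]] _ uI; rewrite !mem_cat.
- by rewrite (map_f (cons 0%N) uI).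
- by rewrite (map_f (cons 1%N) uI) orbT.
- by rewrite (map_f (cons 2%N) uI) !orbT.
Qed.
End CoreSearch.

(** * From enumerated lists back to vertex sets *)

Section CoreTransfer.
Variables (T : finType) (S : {set T}) (a : rel T) (ex u : T -> nat).
Hypotheses (a_sym : symmetric a) (a_irr : irreflexive a).

Let e (A : {set T}) : nat := (mass (edgem a) A)./2.

Hypothesis e_sparse : forall A : {set T}, A \subset S -> A != set0 ->
  (e A < #|A| + \sum_(v in A) ex v)%N.
Hypothesis u_le2 : forall v, (u v <= 2)%N.

Fixpoint seq_edges (l : seq T) : nat :=
  if l is x :: l' then (count (a x) l' + seq_edges l')%N else 0%N.

Fixpoint wgraph_of (l : seq T) : wgraph :=
  if l is x :: l' then (ex x, [seq a x y | y <- l']) :: wgraph_of l' else [::].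

Lemma unzip1_wgraph_of l : unzip1 (wgraph_of l) = map ex l.
Proof. by elim: l => //= x l ->. Qed.

Lemma size_wgraph_of l : size (wgraph_of l) = size l.
Proof. by elim: l => //= x l ->. Qed.

Lemma wedges_wgraph_of mk l : wedges mk (wgraph_of l) = seq_edges (mask mk l).
Proof.
elim: l mk => [|x l IH] [|b mk] //=; rewrite IH; case: b => //=.
by rewrite -map_mask count_map.
Qed.

Lemma wexcess_wgraph_of mk l : wexcess mk (wgraph_of l) = sumn (map ex (mask mk l)).
Proof. by rewrite /wexcess unzip1_wgraph_of -map_mask. Qed.

Lemma sum_set_seq (l : seq T) (f : T -> nat) : uniq l ->
  (\sum_(v in [set x in l]) f v = sumn (map f l))%N.
Proof.
move=> ul; rewrite sumnE big_map big_uniq //=.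
by apply: eq_bigl => v; rewrite inE.
Qed.

Lemma seq_edgesE l : uniq l -> e [set x in l] = seq_edges l.
Proof.
move=> ul; rewrite /e /mass; under eq_bigr do rewrite sum_set_seq //.
rewrite sum_set_seq //; suff -> : sumn [seq sumn [seq edgem a v u | u <- l] | v <- l] = (seq_edges l).*2.
  by rewrite doubleK.
elim: l {ul} => //= x l IH; rewrite {1}/edgem a_irr add0n doubleD.
have -> : sumn [seq edgem a x u | u <- l] = count (a x) l.
  by elim: l {IH} => //= y l ->.
have -> (h : T -> nat) : sumn [seq (edgem a v x + h v)%N | v <- l] =
    (count (a x) l + sumn [seq h v | v <- l])%N.
  by elim: l {IH} => //= y l ->; rewrite /edgem a_sym; lia.
by rewrite IH; lia.
Qed.

Lemma sparse_seq l : uniq l -> {subset l <= S} -> l != [::] ->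
  (seq_edges l < size l + sumn (map ex l))%N.
Proof.
move=> ul lS l0; have := @e_sparse [set x in l]; rewrite seq_edgesE // sum_set_seq //.
rewrite cardsE (card_uniqP ul); apply; first by apply/subsetP => v; rewrite inE => /lS.
by case: l l0 {ul lS} => // x l _; apply/set0Pn; exists x; rewrite !inE eqxx.
Qed.

Lemma wgraph_of_mem K l : uniq l -> {subset l <= S} -> sorted (fun x y => ex y <= ex x)%N l ->
  (sumn (map ex l) <= K)%N -> wgraph_of l \in wgraphs K (size l).
Proof.
elim: l => //= x l IH /andP[xl ul] lS pl sK.
apply/flatten_mapP; exists (wgraph_of l).
  by apply: IH => //; [move=> y yl; apply: lS; rewrite inE yl orbT|exact: path_sorted pl|lia].
apply/flatten_mapP; exists (ex x).
  rewrite mem_filter unzip1_wgraph_of sK andbT mem_iota.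
  by case: l pl {IH xl ul lS} sK => [|y l] /=; [lia|move=> /andP[-> _]; lia].
apply/mapP; exists [seq a x y | y <- l] => //.
rewrite mem_filter mem_all_masks ?size_map // andbT lazy_allE; apply/allP => mk /size_all_masks sz.
rewrite /sparse_mask -[_ :: wgraph_of l]/(wgraph_of (x :: l)).
rewrite wedges_wgraph_of wexcess_wgraph_of -(size_mask (s := x :: l)); last by rewrite /= sz.
apply: sparse_seq => //; first by rewrite mask_uniq //= xl.
by move=> y /mem_mask; apply: lS.
Qed.

Lemma word_sorted_key l : sorted (fun x y => 3 * ex y + u y <= 3 * ex x + u x)%N l ->
  word_sorted (wgraph_of l) (map u l).
Proof.
elim: l => // x [|y l] IH //= /andP[xy p].
have := IH p; case: l {IH p} => [_|z l /= ->]; rewrite ?andbT;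
  by apply/implyP => /eqP exy; move: xy; rewrite exy; lia.
Qed.

Lemma balanced_search : (\sum_(v in S) ex v = 3)%N -> (e S).+1 = (#|S| + 3)%N ->
  #|S| \in [:: 4; 5]%N -> exists r, balanced S e ex u r.
Proof.
move=> X3 tS cS.
(* As [u <= 2], this key orders by excess first and by residue second, as the enumeration
   requires. *)
pose key x := (3 * ex x + u x)%N.
pose ws := sort (fun x y => key y <= key x)%N (enum S).
have kt : total (fun x y => key y <= key x)%N by move=> x y; apply: leq_total.
have uw : uniq ws by rewrite sort_uniq enum_uniq.
have wS x : (x \in ws) = (x \in S) by rewrite mem_sort mem_enum.
have setw : [set x in ws] = S by apply/setP => x; rewrite inE wS.
have szw : size ws = #|S| by rewrite size_sort -cardE.
have sw : sorted (fun x y => key y <= key x)%N ws by apply: sort_sorted.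
have sex : sorted (fun x y => ex y <= ex x)%N ws.
  apply: sub_sorted sw => x y; rewrite /key.
  by have := u_le2 x; have := u_le2 y; lia.
have gI : wgraph_of ws \in wgraphs 3 #|S|.
  rewrite -szw; apply: wgraph_of_mem => //; first by move=> x; rewrite wS.
  by rewrite -sum_set_seq // setw X3.
have tg : tight 3 (wgraph_of ws).
  rewrite /tight unzip1_wgraph_of -sum_set_seq // setw X3 eqxx /= size_wgraph_of wedges_wgraph_of.
  by rewrite mask_true // -seq_edgesE // setw szw tS.
have cg : check_graph (wgraph_of ws).
  have /andP[/allP c4 /allP c5] := check_cores3.
  by move: cS gI; rewrite !inE => /orP[] /eqP->; [move/c4|move/c5]; rewrite tg.
move: cg; rewrite /check_graph size_wgraph_of => /allP/(_ (map u ws)).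
have uI : map u ws \in all_words (size ws).
  by apply: mem_all_words; rewrite ?size_map // all_map; apply/allP => x _ /=.
have us := word_sorted_key sw.
move=> /(_ uI); rewrite us lazy_hasE => /hasP[r]; rewrite mem_filter => /andP[_ /size_all_masks sr].
rewrite /word_ok lazy_allE => /allP ok.
pose rf x := nat_of_bool (nth false r (index x ws)); exists rf => A AS A0.
pose mk := [seq x \in A | x <- ws].
have maskE : mask mk ws = [seq x <- ws | x \in A] by rewrite filter_mask.
have um : uniq (mask mk ws) by rewrite mask_uniq.
have setA : [set x in mask mk ws] = A.
  apply/setP => x; rewrite inE maskE mem_filter wS.
  by case xA: (x \in A) => //=; rewrite (subsetP AS).
have cA : count id mk = #|A|.
  by rewrite -setA cardsE (card_uniqP um) size_mask // size_map.
have rE : [seq (nth false r (index x ws)) | x <- ws] = r.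
  apply: (@eq_from_nth _ false) => [|i]; rewrite size_map ?sr // => iw.
  case/set0Pn: (A0) => x0 _.
  by rewrite (nth_map x0) // index_uniq.
have lwE : lift_word (map u ws) r = [seq (u x + 3 * rf x)%N | x <- ws].
  rewrite -{1}rE /lift_word zip_map -map_comp; apply: eq_map => x /=; by [].
have mI : (mk, ((wedges mk (wgraph_of ws)).+1,
    (3 * count id mk + wexcess mk (wgraph_of ws) - (wedges mk (wgraph_of ws)).+1)%N))
    \in mask_data (wgraph_of ws).
  apply/mapP; exists mk => //; rewrite mem_filter mem_all_masks ?size_map ?size_wgraph_of // andbT.
  by rewrite has_count cA card_gt0.
have := ok _ mI; rewrite /= lwE -map_mask -sum_set_seq // setA cA.
rewrite wedges_wgraph_of wexcess_wgraph_of -sum_set_seq // -seq_edgesE // setA.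
(* Sparsity ensures that the natural subtraction in [mask_data] is not truncated. *)
have := e_sparse AS A0.
move: (e A) #|A| (\sum_(v in A) ex v)%N (\sum_(v in A) (u v + 3 * rf v))%N => p q s t.
by clear; case: ifP => //; lia.
Qed.

Lemma mass_super (A B : {set T}) :
  (mass (edgem a) A + mass (edgem a) B <= mass (edgem a) (A :|: B) + mass (edgem a) (A :&: B))%N.
Proof.
have E (D : {set T}) : mass (edgem a) D = (\sum_v \sum_u ((v \in D) && (u \in D)) * edgem a v u)%N.
  rewrite /mass big_mkcond; apply: eq_bigr => v _; case: (v \in D); last by rewrite big1.
  by rewrite big_mkcond; apply: eq_bigr => w _; case: (w \in D); rewrite ?mul1n ?mul0n.
rewrite !E -!big_split; apply: leq_sum => v _; rewrite -!big_split; apply: leq_sum => w _ /=.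
rewrite !inE -!mulnDl leq_mul2r; apply/orP; right.
by case: (v \in A) (v \in B) (w \in A) (w \in B) => [] [] [] [].
Qed.

(** Excess 4 or more would mean at most four vertices carrying at least [#|S| + 3] edges, too many
    for a simple graph. Excess 3 goes to the search, excess 1 or 2 to the cases of one or two
    vertices of positive excess. *)
Lemma core_balanced : (e S).+1 = (#|S| + \sum_(v in S) ex v)%N ->
  (#|S| + \sum_(v in S) ex v <= 8)%N -> exists r, balanced S e ex u r.
Proof.
move=> tS le8.
have me (A : {set T}) : mass (edgem a) A = (2 * e A)%N.
  by apply: mass_even => [v w|v]; rewrite /edgem ?a_irr // a_sym.
have mle (A : {set T}) : (2 * e A <= #|A| * #|A|.-1)%N.
  rewrite -me; apply: mass_le => [v|v w]; first by rewrite /edgem a_irr.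
  by rewrite /edgem; case: (a v w).
have e_super A B : (e A + e B <= e (A :|: B) + e (A :&: B))%N.
  by have := mass_super A B; rewrite !me; lia.
have e_small (A : {set T}) : A != set0 -> (#|A| <= 2)%N -> (e A < #|A|)%N.
  by rewrite -card_gt0; have := mle A; case: #|A| => [|[|[|?]]] //=; lia.
have [X3|X3|X3] := ltngtP (\sum_(v in S) ex v)%N 3; last first.
- apply: balanced_search => //; first by rewrite tS X3.
  by have := mle S; move: tS le8; rewrite X3; case: #|S| => [|[|[|[|[|[|?]]]]]] //=; lia.
- by exfalso; have := mle S; move: tS le8; case: #|S| => [|[|[|[|[|?]]]]] //=; lia.
case: (posnP (\sum_(v in S) ex v)%N) => [X0|Xp].
  exists (fun=> 0%N); apply: balanced0 => // A AS A0.
  have := e_sparse AS A0; have : (\sum_(v in A) ex v <= \sum_(v in S) ex v)%N.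
    by rewrite [X in (_ <= X)%N](big_setID A) /= (setIidPr AS) leq_addr.
  by rewrite /cycle_rank /zsum X0; lia.
have [z1 z1S e1] : exists2 z, z \in S & (0 < ex z)%N.
  apply/exists_inP; apply: contraLR Xp => /exists_inPn nz; rewrite -eqn0Ngt sum_nat_eq0.
  by apply/forall_inP => v vS; have := nz v vS; rewrite -eqn0Ngt.
have [Xz|Xz] := eqVneq (\sum_(v in S) ex v)%N (ex z1).
  by apply: (balanced_single e_super e_small e_sparse u_le2 z1S); rewrite /zsum; lia.
have XD : (\sum_(v in S) ex v = ex z1 + \sum_(v in S :\ z1) ex v)%N by rewrite (big_setD1 z1).
have Xp2 : (0 < \sum_(v in S :\ z1) ex v)%N by lia.
have [z2 z2S e2] : exists2 z, z \in S :\ z1 & (0 < ex z)%N.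
  apply/exists_inP; apply: contraLR Xp2 => /exists_inPn nz; rewrite -eqn0Ngt sum_nat_eq0.
  by apply/forall_inP => v vS; have := nz v vS; rewrite -eqn0Ngt.
have XD2 : (\sum_(v in S :\ z1) ex v = ex z2 + \sum_(v in S :\ z1 :\ z2) ex v)%N.
  by rewrite (big_setD1 z2).
move: (z2S); rewrite !inE => /andP[z21 z2S'].
apply: (balanced_double e_super e_small e_sparse u_le2 z1S z2S'); first by rewrite eq_sym.
have rest v : v \in S -> v != z1 -> v != z2 -> ex v = 0%N.
  move=> vS v1 v2; have : (\sum_(w in S :\ z1 :\ z2) ex w = 0)%N by lia.
  by move/eqP; rewrite sum_nat_eq0 => /forall_inP/(_ v); rewrite !inE v1 v2 vS => /(_ isT)/eqP.
have exE v : v \in S -> ex v = ((v == z1) + (v == z2))%N.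
  move=> vS; case: (eqVneq v z1) => [->|v1]; first by rewrite eq_sym (negPf z21); lia.
  by case: (eqVneq v z2) => [->|v2]; [lia|rewrite rest].
move=> A AS; rewrite /zsum (eq_bigr (fun v => (v == z1) + (v == z2))%N); last first.
  by move=> v vA; rewrite exE // (subsetP AS).
by rewrite big_split /= !sum_pred1n.
Qed.
End CoreTransfer.

(** * Absorbing sets of vertices into a member of S_3 *)

Section Absorption.
Variable T : finType.
Implicit Types (e : rel T) (H S A W : {set T}).

Definition links e H (w : T) : nat := (\sum_(u in H) e w u)%N.
Definition inner e A : nat := (mass (edgem e) A)./2.
Definition attached e H A : nat := (inner e A + \sum_(w in A) links e H w)%N.

Lemma massE e A : symmetric e -> irreflexive e -> mass (edgem e) A = (2 * inner e A)%N.
Proof. by move=> se ie; apply: mass_even => [u v|v]; rewrite /edgem ?ie // se. Qed.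

Lemma inner0 e : inner e set0 = 0%N.
Proof. by rewrite /inner /mass big_set0. Qed.

Lemma sum_subsetD S A (F : T -> nat) : A \subset S ->
  (\sum_(v in S) F v = \sum_(v in A) F v + \sum_(v in S :\: A) F v)%N.
Proof. exact: big_subsetD. Qed.

Lemma linksU e H S w : [disjoint H & S] -> links e (H :|: S) w = (links e H w + links e S w)%N.
Proof. by move=> HS; rewrite /links; exact: bigUdisj. Qed.

Lemma sum_linksD e S A : A \subset S ->
  (\sum_(w in A) links e S w = mass (edgem e) A + cutm (edgem e) S A)%N.
Proof.
move=> AS; rewrite /cutm /mass -big_split; apply: eq_bigr => w _.
by rewrite /links (big_subsetD _ _ AS).
Qed.

(* Edges of H + S touching A, counted in two ways. *)
Lemma attachedD e H S A : symmetric e -> irreflexive e -> [disjoint H & S] -> A \subset S ->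
  (attached e H S + inner e A =
     attached e H (S :\: A) + \sum_(w in A) links e (H :|: S) w)%N.
Proof.
move=> se ie HS AS; have dE : (\sum_(w in A) links e (H :|: S) w =
    \sum_(w in A) links e H w + \sum_(w in A) links e S w)%N.
  by rewrite -big_split; apply: eq_bigr => w _; rewrite linksU.
have sm u v : edgem e u v = edgem e v u by rewrite /edgem se.
have := @mass_cut _ (edgem e) _ _ sm AS; rewrite dE (sum_linksD e AS) !massE // /attached (sum_subsetD (links e H) AS).
by clear; lia.
Qed.

(** Tightness, compared with the bound for [S :\: A], gives [touch]: degrees are at least 4 and the
    excess over 4 satisfies the sparsity needed for [core_balanced]. For the resulting out-degrees,
    [balanced] is precisely the strict cut condition. *)
Lemma absorb_tight e H S : symmetric e -> irreflexive e -> [disjoint H & S] ->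
  S3on (edgem e) H ->
  (forall A, A \subset S -> A != S -> (attached e H A <= 3 * #|A|)%N) ->
  attached e H S = (3 * #|S|).+1 -> (3 * #|S| <= \sum_(w in S) links e H w + 6)%N ->
  S3on (edgem e) (H :|: S).
Proof.
move=> se ie HS S3H low tight D6.
pose dg w := links e (H :|: S) w.
have touch A : A \subset S -> A != set0 -> (3 * #|A| + inner e A < \sum_(w in A) dg w)%N.
  move=> AS A0; have := attachedD se ie HS AS; rewrite -/dg tight.
  have DS : S :\: A != S.
    apply: contraNneq A0 => E; rewrite -(setIidPr AS) -E setIC setIDA.
    by rewrite setDIl setDv set0I.
  have := low _ (subsetDl S A) DS; have := cardsID A S; rewrite (setIidPr AS).
  by move: (attached _ _ _) (inner _ _) (\sum_(w in A) _)%N; clear; lia.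
have inner1 w : inner e [set w] = 0%N by rewrite /inner /mass !big_set1 /edgem ie.
have dg4 w : w \in S -> (4 <= dg w)%N.
  move=> wS; have := touch [set w]; rewrite sub1set wS cards1 inner1 big_set1.
  have w0 : [set w] != set0 by apply/set0Pn; exists w; rewrite inE.
  by move=> /(_ isT w0); clear; lia.
pose ex w := (dg w - 4)%N.
have dgE A : A \subset S -> (\sum_(w in A) dg w = 4 * #|A| + \sum_(w in A) ex w)%N.
  move=> AS; rewrite mulnC -sum_nat_const -big_split; apply: eq_bigr => w wA /=.
  by have := dg4 w (subsetP AS w wA); rewrite /ex; lia.
apply: S3on_extend => // beta.
(* Solves [2 * (u w + 1) - dg w = beta w] modulo 3, 2 being its own inverse; the out-degree of [w]
   will be [u w + 3 * r w + 1]. *)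
pose u w : nat := `|((2 * (beta w + (dg w)%:Z - 2)) %% 3)%Z|%N.
have u2 w : (u w <= 2)%N by rewrite /u; lia.
have [A AS A0|||r bal] := @core_balanced T S e ex u se ie _ u2.
- by have := touch A AS A0; rewrite dgE // -/(inner e A); clear; lia.
- have := attachedD se ie HS (subxx S); rewrite setDv tight -/dg.
  rewrite /attached inner0 big_set0 dgE // -/(inner e S); clear; lia.
- have := attachedD se ie HS (subxx S); rewrite setDv -/dg.
  move: D6 tight; rewrite /attached inner0 big_set0 dgE //; clear; lia.
pose b w : int := 2 * (u w + 3 * r w)%N%:Z + 2 - (dg w)%:Z.
apply: (@local_of_net _ _ _ _ _ b) => //.
- by move=> v w; rewrite /edgem se.
- by move=> v; rewrite /edgem ie.
- by move=> w wS; rewrite /b /u; lia.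
- move=> w wS; rewrite -PoszS.
  have -> : (\sum_(v in H :|: S) edgem e w v)%N = dg w by [].
  by rewrite /b; lia.
move=> A AS A0; have [lo up] := bal A AS A0.
have bE : \sum_(w in A) b w =
    2 * (\sum_(w in A) (u w + 3 * r w))%N%:Z + 2 * #|A|%:Z - (\sum_(w in A) dg w)%N%:Z.
  rewrite /b sumzB sumzD -PoszS; congr (_ + _ - _); first by rewrite PoszS mulr_sumr.
  by rewrite sumr_const; lia.
have cE := sum_linksD e (subset_trans AS (subsetUr H S)).
rewrite massE // in cE; rewrite bE.
move: lo up cE; rewrite -/(inner e A) -/dg dgE //.
move: (inner e A) #|A| (\sum_(w in A) ex w)%N (\sum_(w in A) (u w + 3 * r w))%N (cutm _ _ _).
by clear; lia.
Qed.

Lemma absorb_vertex (m : T -> T -> nat) H w : (forall u v, m u v = m v u) ->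
  (forall v, m v v = 0%N) -> w \notin H -> S3on m H ->
  (4 <= \sum_(u in H) m w u)%N -> S3on m (w |: H).
Proof.
move=> sm irr wH S3H c4; rewrite setUC.
have HS : [disjoint H & [set w]] by rewrite disjoint_sym disjoints1.
apply: S3on_extend => // beta.
(* The representative in [-2, 3] of the residue modulo 6 fixed by [beta] and the degree parity; its
   absolute value is below 4, so four edges suffice. *)
pose b v : int := ((3 * (\sum_(u in H) m w u)%N%:Z - 2 * beta v + 2) %% 6)%Z - 2.
have lE v : v \in [set w] -> (\sum_(u in H :|: [set w]) m v u = \sum_(u in H) m w u)%N.
  by move=> /set1P->; rewrite bigUdisj //= big_set1 irr addn0.
apply: (@local_of_net _ _ _ _ _ b) => //.
- by move=> v _; rewrite /b; lia.
- by move=> v vS; rewrite -PoszS lE // /b; lia.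
move=> A AS A0; have -> : A = [set w].
  by move: AS; rewrite subset1 (negPf A0) orbF => /eqP.
rewrite big_set1 /cutm big_set1 setDUl setDv setU0.
have -> : H :\: [set w] = H by apply/setDidPl.
by move: c4; rewrite /b; lia.
Qed.

Definition del_edge e (p q : T) : rel T :=
  fun x y => e x y && ~~ (((x == p) && (y == q)) || ((x == q) && (y == p))).

Lemma del_edge_sym e p q : symmetric e -> symmetric (del_edge e p q).
Proof.
by move=> se x y; rewrite /del_edge se orbC [(y == q) && _]andbC [(y == p) && _]andbC.
Qed.

Lemma del_edge_irr e p q : irreflexive e -> irreflexive (del_edge e p q).
Proof. by move=> ie x; rewrite /del_edge ie. Qed.

Lemma del_edgeK e p q : symmetric e -> irreflexive e -> e p q ->
  addE (edgem (del_edge e p q)) p q =2 edgem e.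
Proof.
move=> se ie epq x y; rewrite /addE /edgem /del_edge.
have pq : p != q by apply: contraTneq epq => ->; rewrite ie.
case: (boolP ((x == p) && (y == q))) => [/andP[/eqP-> /eqP->]|_] /=.
  by rewrite epq (negPf pq) andbF.
case: (boolP ((x == q) && (y == p))) => [/andP[/eqP-> /eqP->]|_] /=.
  by rewrite se epq.
by rewrite andbT !addn0.
Qed.

Lemma attached_del_edge e H S p q A : symmetric e -> irreflexive e -> [disjoint H & S] ->
  e p q -> p \in S -> q \in S -> A \subset S ->
  (attached e H A = attached (del_edge e p q) H A + ((p \in A) && (q \in A)))%N.
Proof.
move=> se ie HS epq pS qS AS.
have pq : p != q by apply: contraTneq epq => ->; rewrite ie.
have nH v : v \in S -> v \notin H by move=> vS; rewrite (disjointFl HS vS).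
have lE w : w \in A -> links e H w = links (del_edge e p q) H w.
  move=> wA; apply: eq_bigr => u uH; rewrite /del_edge.
  have [up uq] : u != p /\ u != q by split; apply: contraTneq uH => ->; apply: nH.
  by rewrite (negPf up) (negPf uq) !andbF /= andbT.
rewrite /attached (eq_bigr _ lE).
suff : (mass (edgem e) A = mass (edgem (del_edge e p q)) A + 2 * ((p \in A) && (q \in A)))%N.
  rewrite !massE //; [|exact: del_edge_sym|exact: del_edge_irr].
  by move: (inner e A) (inner _ A) (p \in A) (q \in A); clear; lia.
have E : mass (edgem e) A = mass (addE (edgem (del_edge e p q)) p q) A.
  by apply: eq_bigr => x _; apply: eq_bigr => y _; rewrite del_edgeK.
have ind (a c : T) : (\sum_(x in A) \sum_(y in A) ((x == a) && (y == c)) = (a \in A) && (c \in A))%N.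
  transitivity (\sum_(x in A) (x == a) * (c \in A))%N; last by rewrite -big_distrl /= sum_pred1n mulnb.
  apply: eq_bigr => x _; rewrite -(sum_pred1n A c) big_distrr; apply: eq_bigr => y _.
  by rewrite /= mulnb.
rewrite E /mass /addE.
under eq_bigr do rewrite !big_split /=.
by rewrite !big_split /= !ind [(q \in A) && _]andbC; lia.
Qed.

(** Deleting an edge inside [S] preserves the bounds on proper subsets and the links to [H], so
    edges are deleted until [S] is tight and restored by [S3on_addE]. An inner edge exists, since
    otherwise the bounds on singletons would add up to the bound for [S]. *)
Lemma absorb_minimal e H S : symmetric e -> irreflexive e -> [disjoint H & S] ->
  S3on (edgem e) H -> (1 < #|S|)%N ->
  (forall A, A \subset S -> A != S -> (attached e H A <= 3 * #|A|)%N) ->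
  (3 * #|S| < attached e H S)%N -> (3 * #|S| <= \sum_(w in S) links e H w + 6)%N ->
  S3on (edgem e) (H :|: S).
Proof.
have [n] := ubnP (attached e H S); elim: n e => // n IH e; rewrite ltnS => en se ie HS S3H S2 low.
rewrite leq_eqVlt => /orP[/eqP tight D6|gt D6]; first exact: absorb_tight.
have [p [q [pS qS epq]]] : exists p q, [/\ p \in S, q \in S & e p q].
  case: (boolP [exists p in S, [exists q in S, e p q]]).
    by move=> /exists_inP[p pS /exists_inP[q qS epq]]; exists p, q.
  move=> /exists_inPn ne; exfalso.
  have i0 A : A \subset S -> inner e A = 0%N.
    move=> AS; rewrite /inner /mass big1 // => x xA; rewrite big1 // => y yA.
    have := ne x (subsetP AS x xA) => /exists_inPn/(_ y (subsetP AS y yA)).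
    by rewrite /edgem => /negPf->.
  have : (\sum_(w in S) links e H w <= \sum_(w in S) 3)%N.
    apply: leq_sum => w wS; have := low [set w]; rewrite sub1set wS /attached cards1 big_set1.
    rewrite i0 ?sub1set // => /(_ isT); apply.
    by apply: contraTneq S2 => <-; rewrite cards1.
  rewrite sum_nat_const; move: gt; rewrite /attached i0 //.
  by move: (\sum_(w in S) _)%N #|S|; clear; lia.
pose e' := del_edge e p q.
have attE A : A \subset S -> (attached e H A = attached e' H A + ((p \in A) && (q \in A)))%N.
  exact: attached_del_edge.
have nH v : v \in S -> v \notin H by move=> vS; rewrite (disjointFl HS vS).
have eH u v : v \in H -> e' u v = e u v.
  move=> vH; have [vp vq] : v != p /\ v != q by split; apply: contraTneq vH => ->; apply: nH.
  by rewrite /e' /del_edge (negPf vp) (negPf vq) !andbF /= andbT.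
have S3' : S3on (edgem e') (H :|: S).
  have attS := attE S (subxx S); rewrite pS qS /= in attS.
  apply: IH => //.
  - by rewrite -ltnS; move: en; rewrite attS addn1.
  - exact: del_edge_sym.
  - exact: del_edge_irr.
  - by apply: S3on_eq S3H => u v uH vH; rewrite /edgem eH.
  - by move=> A AS AnS; have := low A AS AnS; rewrite attE //; apply: leq_trans; rewrite leq_addr.
  - by move: gt; rewrite attS addn1.
  - rewrite (eq_bigr (links e H)) // => w _; by apply: eq_bigr => u uH; rewrite eH.
have HSp : p \in H :|: S by rewrite inE pS orbT.
have HSq : q \in H :|: S by rewrite inE qS orbT.
by apply: S3on_eq (S3on_addE HSp HSq S3') => u v _ _; rewrite del_edgeK.
Qed.

(** A minimal overfull subset of [W] is absorbed. When no vertex has four links, those outside the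
    subset contribute nonnegatively to the deficit, so the subset has deficit at most 6 as well. *)
Lemma absorb e H W : symmetric e -> irreflexive e -> [disjoint H & W] -> S3on (edgem e) H ->
  (3 * #|W| < attached e H W)%N -> (3 * #|W| <= \sum_(w in W) links e H w + 6)%N ->
  exists A, [/\ A \subset W, A != set0 & S3on (edgem e) (H :|: A)].
Proof.
move=> se ie HW S3H rW D6.
case: (boolP [exists w in W, (4 <= links e H w)%N]) => [/exists_inP[w wW c4]|/exists_inPn c3].
  exists [set w]; split; rewrite ?sub1set //; first by apply/set0Pn; exists w; rewrite inE.
  rewrite setUC; apply: absorb_vertex => // [u v|v|]; rewrite /edgem ?ie //; first by rewrite se.
  by rewrite (disjointFl HW wW).
pose P (A : {set T}) := (3 * #|A| < attached e H A)%N.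
have [A /minsetP[PA minA] AW] := minset_exists (P := P) rW.
have HA : [disjoint H & A] by rewrite disjoint_sym (disjointWl AW) // disjoint_sym.
have A0 : A != set0.
  by apply: contraTneq PA => ->; rewrite /P /attached inner0 big_set0 cards0.
exists A; split=> //; apply: absorb_minimal => //.
- rewrite ltnNge leq_eqVlt ltnS leqn0 cards_eq0 (negPf A0) orbF; apply/negP => /cards1P[w Aw].
  have := c3 w; rewrite -sub1set -Aw AW => /(_ isT); apply/negP; rewrite negbK.
  move: PA; rewrite /P Aw /attached cards1 big_set1 /inner /mass !big_set1 /edgem ie.
  by move: (links _ _ _); clear; lia.
- move=> B BA BnA; rewrite leqNgt; apply: contra BnA => PB; apply/eqP; exact: minA.
- have : (\sum_(w in W :\: A) links e H w <= \sum_(w in W :\: A) 3)%N.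
    apply: leq_sum => w; rewrite inE => /andP[_ wW]; have := c3 w wW; clear; lia.
  move: D6; rewrite (sum_subsetD _ AW) sum_nat_const -(cardsID A W) (setIidPr AW).
  by move: (\sum_(w in A) _)%N (\sum_(w in _ :\: _) _)%N; clear; lia.
Qed.
End Absorption.

(** * The complement of a maximal member of S_3 *)

Section Residue.
Variable T : finType.
Implicit Types (e f : rel T) (H S A B W X : {set T}).

Definition S3max e H := S3on (edgem e) H /\
  forall A, A != set0 -> [disjoint H & A] -> ~ S3on (edgem e) (H :|: A).

Lemma card_arcs e A B :
  (\sum_(w in A) \sum_(u in B) e w u)%N = #|[set p | [&& p.1 \in A, p.2 \in B & e p.1 p.2]]|.
Proof.
rewrite -sum1_card [RHS]big_mkcond [LHS]big_mkcond.
transitivity (\sum_w \sum_u [&& w \in A, u \in B & e w u])%N.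
  apply: eq_bigr => w _; case: (w \in A); last by rewrite big1.
  by rewrite big_mkcond; apply: eq_bigr => u _; case: (u \in B).
by rewrite pair_bigA /=; apply: eq_bigr => -[w u] _; rewrite inE /=; case: ifP.
Qed.

Lemma edgeP e (D : {set T}) : reflect (exists x y, D = [set x; y] /\ e x y) (D \in edges e).
Proof.
rewrite inE; apply: (iffP existsP) => [[x /existsP[y /andP[/eqP-> exy]]]|[x [y [-> exy]]]].
  by exists x, y.
by exists x; apply/existsP; exists y; rewrite eqxx.
Qed.

Lemma card_inner_edges e W : symmetric e -> irreflexive e ->
  (#|[set D in edges e | D \subset W]| <= inner e W)%N.
Proof.
move=> se ie; set I := [set D in _ | _].
suff : (#|I| * 2 <= mass (edgem e) W)%N by rewrite massE //; lia.
rewrite /mass card_arcs -[X in (_ <= X)%N]sum1_card; pose h (p : T * T) := [set p.1; p.2].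
rewrite (partition_big h (mem I)) /=; last first.
  move=> [x y]; rewrite !inE /h /= => /and3P[xW yW exy]; rewrite subUset !sub1set xW yW !andbT.
  by apply/existsP; exists x; apply/existsP; exists y; rewrite eqxx.
rewrite -sum_nat_const; apply: leq_sum => D; rewrite inE => /andP[/edgeP[x [y [-> exy]]]].
rewrite subUset !sub1set => /andP[xW yW].
have xy : x != y by apply: contraTneq exy => ->; rewrite ie.
rewrite (bigD1 (x, y)) ?inE /= ?xW ?yW ?exy ?eqxx // (bigD1 (y, x)) /=; first by rewrite addnA leq_addr.
by rewrite !inE /= xW yW se exy /h /= setUC eqxx -pair_eqE /= negb_and eq_sym xy.
Qed.

Lemma card_cut_edges e W : symmetric e -> irreflexive e ->
  (#|[set D in edges e | #|D :&: W| == 1%N]| <= \sum_(w in W) \sum_(u in ~: W) e w u)%N.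
Proof.
move=> se ie; rewrite card_arcs; pose h (p : T * T) := [set p.1; p.2].
apply: leq_trans (leq_imset_card h _); apply/subset_leq_card/subsetP => D.
rewrite inE => /andP[/edgeP[x [y [-> exy]]] c1].
have xy : x != y by apply: contraTneq exy => ->; rewrite ie.
case xW: (x \in W); case yW: (y \in W).
- move: c1; have /setIidPl-> : [set x; y] \subset W by rewrite subUset !sub1set xW yW.
  by rewrite cards2 xy.
- by apply/imsetP; exists (x, y); rewrite // !inE /= xW yW exy.
- by apply/imsetP; exists (y, x); rewrite /h /= 1?setUC // !inE /= xW yW se exy.
- move: c1; have -> : [set x; y] :&: W = set0; last by rewrite cards0.
  by apply/setP => z; rewrite !inE; case: eqP => [->|_]; case: eqP => [->|_]; rewrite ?xW ?yW ?andbF.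
Qed.

Lemma S3max_exists e H : S3on (edgem e) H -> exists2 M : {set T}, H \subset M & S3max e M.
Proof.
have [n] := ubnP #|~: H|; elim: n H => // n IH H; rewrite ltnS => Hn S3H.
have [[A [A0 HA S3A]]|nex] := classic (exists A, [/\ A != set0, [disjoint H & A] &
    S3on (edgem e) (H :|: A)]); last first.
  by exists H => //; split=> // A A0 HA S3A; apply: nex; exists A.
have [|M HM maxM] := IH (H :|: A) _ S3A.
  apply: leq_trans Hn; apply: proper_card; rewrite setCU; apply/properP; split; first exact: subsetIl.
  case/set0Pn: A0 => v vA; exists v; rewrite !inE ?vA ?andbF //.
  by rewrite (disjointFl HA vA).
by exists M => //; apply: subset_trans HM; apply: subsetUl.
Qed.

Variables (e : rel T) (H : {set T}).
Hypotheses (se : symmetric e) (ie : irreflexive e) (deg4 : forall v, (4 <= deg e v)%N).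
Hypotheses (maxH : S3max e H) (W0 : ~: H != set0).

Let W := ~: H.
Let c := (\sum_(w in W) links e H w)%N.

Let HW : [disjoint H & W].
Proof. by rewrite /W disjoints_subset setCK. Qed.

Let HUW : H :|: W = setT.
Proof. exact: setUCr. Qed.

Lemma deg_links v : deg e v = links e setT v.
Proof.
rewrite /deg /links -sum1_card big_mkcond [RHS]big_mkcond.
by apply: eq_bigr => u _; rewrite !inE; case: (e v u).
Qed.

Lemma max_links w : w \in W -> (links e H w <= 3)%N.
Proof.
move=> wW; rewrite leqNgt; apply/negP => c4; case: maxH => S3H.
have w0 : [set w] != set0 by apply/set0Pn; exists w; rewrite inE.
move=> /(_ [set w] w0); rewrite disjoint_sym disjoints1 (disjointFl HW wW) => /(_ isT); apply.
rewrite setUC; apply: absorb_vertex => // [u v|v|]; rewrite /edgem ?ie //; first by rewrite se.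
by rewrite (disjointFl HW wW).
Qed.

Lemma max_links_sum : (c <= 3 * #|W|)%N.
Proof.
by rewrite mulnC -sum_nat_const; apply: leq_sum => w wW; apply: max_links.
Qed.

Lemma max_degree_sum : (4 * #|W| <= 2 * inner e W + c)%N.
Proof.
rewrite mulnC -sum_nat_const -massE // /c /mass -big_split; apply: leq_sum => w wW /=.
by rewrite (leq_trans (deg4 w)) // deg_links -HUW linksU // addnC.
Qed.

Lemma max_attached : (3 * #|W| <= c + 6)%N -> (attached e H W <= 3 * #|W|)%N.
Proof.
move=> D6; rewrite leqNgt; apply/negP => rW; have [S3H nabs] := maxH.
have [A [AW A0 S3A]] := absorb se ie HW S3H rW D6.
by apply: nabs S3A => //; rewrite disjoint_sym (disjointWl AW) // disjoint_sym.
Qed.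

(** Let D be the deficit. If D is at most 6, then [max_attached] gives at most D inner edges, while
    minimum degree 4 gives |W| + D at most twice their number; hence |W| is at most D. As at most
    |W|(|W| - 1)/2 inner edges exist, |W| and D are at least 3. *)
Lemma max_deficit : [/\ (3 <= #|W|)%N, (c + 3 <= 3 * #|W|)%N &
  (3 * #|W| <= c + 6)%N -> (c + #|W| <= 3 * #|W|)%N].
Proof.
have := max_attached; have := max_degree_sum; have := max_links_sum.
have : (mass (edgem e) W <= #|W| * #|W|.-1)%N.
  by apply: mass_le => [v|u v]; rewrite /edgem ?ie //; case: (e u v).
rewrite massE //; have : (0 < #|W|)%N by rewrite card_gt0.
rewrite /attached -/c; move: (inner e W) c #|W|; clear => i d [|[|[|k]]] //= _ *; split; lia.
Qed.

Lemma max_bad : (3 * #|W| <= c + 6)%N -> has_bad_attachment e.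
Proof.
move=> D6; have := max_attached D6; have [W3 c3 /(_ D6) cW] := max_deficit.
rewrite /attached -/c => att; exists W; split; first by lia.
apply: leq_trans att; rewrite addnC leq_add ?card_inner_edges //.
by apply: leq_trans (card_cut_edges _ se ie) _; rewrite /W setCK.
Qed.

(** For zero boundary the targets on [W] are 0 at even and plus or minus 3 at odd degrees. Two odd
    vertices get opposite signs, so that every partial sum is at most 3 in absolute value, while
    every nonempty part of [W] is left by at least four edges. *)
Lemma max_flow : (3 * #|W| <= c + 6)%N -> flow_index_lt3 e.
Proof.
move=> D6; have := max_attached D6; have [W3 c3 /(_ D6) cW] := max_deficit.
rewrite /attached -/c => att.
pose dg w := links e setT w.
have dg4 w : (4 <= dg w)%N by rewrite /dg -deg_links.
pose O := [set w in W | odd (dg w)].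
have O2 : (#|O| <= 2)%N.
  have : (\sum_(w in W) (4 + (w \in O)) <= \sum_(w in W) dg w)%N.
    apply: leq_sum => w wW; rewrite inE wW /=; have := dg4 w.
    by case: (boolP (odd (dg w))); lia.
  rewrite big_split /= sum_nat_const.
  have -> : (\sum_(w in W) (w \in O) = #|O|)%N.
    rewrite -sum1_card big_mkcond [RHS]big_mkcond; apply: eq_bigr => w _.
    by rewrite [w \in O]in_set; case: (w \in W); case: (odd _).
  have -> : (\sum_(w in W) dg w = 2 * inner e W + c)%N.
    rewrite -massE // /c /mass -big_split; apply: eq_bigr => w wW /=.
    by rewrite /dg -HUW linksU // addnC.
  have : (2 * inner e W <= #|W| * #|W|.-1)%N.
    rewrite -massE //.
    by apply: mass_le => [v|u v]; rewrite /edgem ?ie //; case: (e u v).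
  move: att D6 c3 W3 cW; move: (inner e W) c #|W| #|O|; clear => i d [|[|[|[|k]]]] o //=; lia.
have [o Oo] : exists o, (#|O :\ o| <= 1)%N.
  case: (set_0Vmem O) => [->|[o oO]]; last by exists o; rewrite (cardsD1 o) oO in O2; lia.
  by case/set0Pn: W0 => o _; exists o; rewrite set0D cards0.
pose b w : int := if w \in O then if w == o then 3 else -3 else 0.
have [S3H _] := maxH.
have [y ly] : exists y, local_good (edgem e) H W (fun=> 0) y.
  apply: (@local_of_net _ _ _ _ _ b) => //.
  - by move=> u v; rewrite /edgem se.
  - by move=> v; rewrite /edgem ie.
  - by move=> w wW; rewrite /b; case: ifP => // _; case: ifP.
  - move=> w wW; rewrite -PoszS HUW.
    have -> : (\sum_(u in setT) edgem e w u)%N = dg w by [].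
    by rewrite /b inE wW /=; case: (boolP (odd (dg w))) => ?; [case: ifP => _|]; lia.
  move=> A AW A0; rewrite HUW.
  have b3 : `|\sum_(w in A) b w| <= 3.
    have -> : \sum_(w in A) b w = \sum_(w in A) (3 * ((w \in O) && (w == o))%:Z -
        3 * (w \in O :\ o)%:Z).
      by apply: eq_bigr => w _; rewrite /b in_setD1; case: (w \in O); case: (w == o).
    rewrite sumzB -!mulr_sumr -!PoszS.
    have : (\sum_(w in A) ((w \in O) && (w == o)) <= 1)%N.
      case oA: (o \in A); last first.
        rewrite big1 // => w wA; case: eqP => [wo|]; last by rewrite andbF.
        by rewrite -wo wA in oA.
      by rewrite (bigD1 o) //= big1 ?addn0 ?leq_b1 // => w /andP[_ /negPf->]; rewrite andbF.
    have : (\sum_(w in A) (w \in O :\ o) <= 1)%N.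
      apply: leq_trans Oo; rewrite -sum1_card [X in (X <= _)%N]big_mkcond [X in (_ <= X)%N]big_mkcond.
      by apply: leq_sum => w _; case: (w \in A); case: (w \in _ :\ _).
    by move: (\sum_(w in A) _)%N (\sum_(w in A) _)%N; clear; lia.
  have cE : (cutm (edgem e) setT A = \sum_(w in A) dg w - mass (edgem e) A)%N.
    by rewrite sum_linksD ?subsetT // addKn.
  have d4 : (4 * #|A| <= \sum_(w in A) dg w)%N by rewrite mulnC -sum_nat_const; apply: leq_sum.
  have mA : (mass (edgem e) A <= #|A| * #|A|.-1)%N.
    by apply: mass_le => [v|u v]; rewrite /edgem ?ie //; case: (e u v).
  have mW : (mass (edgem e) A <= 2 * inner e W)%N.
    rewrite -massE // /mass (sum_subsetD _ AW) /=; apply: leq_trans (leq_addr _ _).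
    by apply: leq_sum => w _; rewrite (sum_subsetD _ AW) leq_addr.
  have aW := subset_leq_card AW; have : (0 < #|A|)%N by rewrite card_gt0.
  move: d4 mA mW aW att D6 b3; rewrite cE.
  move: (\sum_(w in A) b w) (\sum_(w in A) dg w)%N (mass _ _) (inner e W) c #|W| #|A|.
  by clear => s1 s2 s3 s4 s5 s6 [|[|[|[|a]]]] //=; lia.
have [|x gx] := extend HW S3H ly; first by rewrite big1.
by rewrite HUW in gx; apply: flow_of_good gx.
Qed.
End Residue.

(** * A member of S_3 in the complementary graph *)

Section Hubs.
Variable T : finType.
Implicit Types (m : T -> T -> nat) (e f : rel T) (U H S A B W X Y : {set T}).

Definition simple_mult m := (forall u v, m u v = m v u) /\ (forall v, m v v = 0%N).

Definition addEs m (l : seq (T * T)) : T -> T -> nat :=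
  foldr (fun p m' => addE m' p.1 p.2) m l.

Lemma addE_simple m a c : a != c -> simple_mult m -> simple_mult (addE m a c).
Proof.
move=> ac [sm irr]; split=> [u v|v]; rewrite /addE.
  by rewrite sm -!addnA; congr (_ + _)%N; rewrite addnC [(v == a) && _]andbC [(v == c) && _]andbC.
by rewrite irr; case: eqP => [->|_] /=; [rewrite (negPf ac) | rewrite andbF].
Qed.

Lemma addEs_simple m l : {in l, forall p : T * T, p.1 != p.2} -> simple_mult m -> simple_mult (addEs m l).
Proof.
elim: l => //= p l IH pl sm; apply: addE_simple; first by apply: pl; rewrite inE eqxx.
by apply: IH => // q ql; apply: pl; rewrite inE ql orbT.
Qed.

Lemma addEs_ge m l u v : (m u v <= addEs m l u v)%N.
Proof. by elim: l => //= p l IH; rewrite /addE -addnA (leq_trans IH) ?leq_addr. Qed.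

Lemma addEs_pair m l a c : (a, c) \in l -> (m a c < addEs m l a c)%N.
Proof.
elim: l => //= p l IH; rewrite inE => /orP[/eqP<-|/IH lt]; rewrite /addE /=.
  by rewrite !eqxx -addnA addnS ltnS (leq_trans (addEs_ge m l a c)) ?leq_addr.
by rewrite -addnA (leq_trans lt) ?leq_addr.
Qed.

Lemma addEs_outside m l U u v : {in l, forall p : T * T, ~~ ((p.1 \in U) && (p.2 \in U))} ->
  u \in U -> v \in U -> addEs m l u v = m u v.
Proof.
move=> + uU vU; elim: l => //= p l IH pl; rewrite /addE IH; last first.
  by move=> q ql; apply: pl; rewrite inE ql orbT.
have np := pl p (mem_head p l).
have -> : (u == p.1) && (v == p.2) = false.
  by apply: contraNF np => /andP[/eqP<- /eqP<-]; rewrite uU.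
have -> : (u == p.2) && (v == p.1) = false; last by rewrite !addn0.
by apply: contraNF np => /andP[/eqP<- /eqP<-]; rewrite vU.
Qed.

Lemma lift_all m U (l : seq (T * T)) (bs : seq T) : simple_mult m -> size bs = size l -> uniq bs ->
  {in bs, forall b, b \notin U} ->
  {in l, forall p : T * T, [/\ p.1 \in U, p.2 \in U & p.1 != p.2]} ->
  {in bs & l, forall b (p : T * T), (0 < m b p.1)%N && (0 < m b p.2)%N} ->
  {in bs, forall b, (4 <= \sum_(u in U) m b u)%N} ->
  S3on (addEs m l) U -> S3on m (U :|: [set b in bs]).
Proof.
move=> sm; elim: l bs U => [|p l IH] [|b bs] U //= => [_ _ _ _ _ _ S3|].
  by have -> : U :|: [set b in [::]] = U by apply/setP => v; rewrite !inE orbF.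
move=> [sz] /andP[bbs ubs] bsU lU adj deg S3.
have -> : U :|: [set x in b :: bs] = (b |: U) :|: [set x in bs].
  by apply/setP => v; rewrite !inE orbCA orbA.
have [pU1 pU2 p12] := lU p (mem_head p l).
have bU := bsU b (mem_head b bs).
have lne : {in l, forall q : T * T, q.1 != q.2}.
  by move=> q ql; have [] := lU q _; rewrite ?inE ?ql ?orbT.
have [sml irrl] := addEs_simple lne sm.
have ge := addEs_ge m l.
apply: IH => //.
- move=> b' b'bs; rewrite !inE negb_or bsU ?inE ?b'bs ?orbT // andbT.
  by apply: contraNneq bbs => <-.
- by move=> q ql; have [] := lU q _; rewrite ?inE ?ql ?orbT // => -> ->; rewrite !orbT.
- by move=> b' q b'bs ql; apply: adj; rewrite inE ?b'bs ?ql orbT.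
- move=> b' b'bs; rewrite big_setU1 //= (leq_trans (deg b' _)) ?leq_addl //.
  by rewrite inE b'bs orbT.
have /andP[a1 a2] := adj b p (mem_head b bs) (mem_head p l).
apply: (@S3on_lift _ _ _ b p.1 p.2) => //.
- exact: leq_trans a1 (ge _ _).
- exact: leq_trans a2 (ge _ _).
- by apply: leq_trans (deg b (mem_head b bs)) _; apply: leq_sum.
Qed.

(* The leaves [bs] are first lifted to edges between z and U, then z to the edge ac. *)
Lemma star_lift m U z a c (l : seq (T * T)) (bs : seq T) : simple_mult m -> z \notin U ->
  a \in U -> c \in U -> a != c -> {in l, forall p : T * T, p.1 = z /\ p.2 \in U} ->
  (0 < addEs m l z a)%N -> (0 < addEs m l z c)%N -> (4 <= \sum_(u in U) addEs m l z u)%N ->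
  size bs = size l -> uniq bs -> {in bs, forall b, b \notin z |: U} ->
  {in bs & l, forall b (p : T * T), (0 < m b p.1)%N && (0 < m b p.2)%N} ->
  {in bs, forall b, (4 <= \sum_(u in z |: U) m b u)%N} ->
  S3on (addE m a c) U -> S3on m ((z |: U) :|: [set b in bs]).
Proof.
move=> sm zU aU cU ac lz za zc z4 sz ubs bsU adj deg S3.
have lne : {in l, forall p : T * T, p.1 != p.2}.
  by move=> p pl; have [-> pU] := lz p pl; apply: contraNneq zU => ->.
have [sml irrl] := addEs_simple lne sm.
apply: (lift_all sm sz ubs bsU _ adj deg) => [p pl|].
  by have [pz pU] := lz p pl; split; rewrite ?lne // ?pz !inE ?eqxx ?pU ?orbT.
apply: (@S3on_lift _ _ _ z a c) => //.
apply: S3on_eq S3 => u v uU vU; rewrite /addE (@addEs_outside m l U) // => p pl.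
by have [-> _] := lz p pl; rewrite (negPf zU).
Qed.

(* Four parallel edges form a member of S_3, hence so does this tree with multiplicity four. *)
Definition hub_star (a : T) (s : seq T) : seq (T * T) := flatten [seq nseq 4 (a, b) | b <- s].

Lemma addEs_count m l u v : (count_mem (u, v) l <= addEs m l u v)%N.
Proof.
elim: l => //= p l IH; rewrite /addE; case: (eqVneq p (u, v)) => [->|_] /=.
  by rewrite !eqxx; lia.
by rewrite add0n -addnA (leq_trans IH) ?leq_addr.
Qed.

Lemma S3on_hub_star a s m : simple_mult m -> uniq (a :: s) ->
  S3on (addEs m (hub_star a s)) [set x in a :: s].
Proof.
move=> sm /= /andP[as_ us]; set l := hub_star a s.
have [sml irrl] : simple_mult (addEs m l).
  apply: addEs_simple => // p /flatten_mapP[b bs]; rewrite mem_nseq => /eqP->.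
  by apply: contraNneq as_ => /= ->.
have four b : b \in s -> (4 <= addEs m l b a)%N.
  move=> bs; rewrite sml; apply: leq_trans (addEs_count _ _ _ _); rewrite /l.
  have hsE x t : hub_star a (x :: t) = nseq 4 (a, x) ++ hub_star a t by [].
  elim: (s) bs => // x t IH; rewrite inE hsE count_cat count_nseq.
  case: (eqVneq b x) => [-> _|_ /= /IH]; first by rewrite /= eqxx mul1n leq_addr.
  by move/leq_trans; apply; apply: leq_addl.
suff K t : {subset t <= s} -> uniq t -> S3on (addEs m l) [set x in a :: t] by apply: K.
elim: t => [_ _|x t IH ts /andP[xt ut]].
  have -> : [set x in [:: a]] = [set a] by apply/setP => v; rewrite !inE.
  exact: S3on1.
have -> : [set y in [:: a, x & t]] = x |: [set y in a :: t].
  by apply/setP => v; rewrite !inE orbCA.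
have xs : x \in s by apply: ts; rewrite inE eqxx.
apply: absorb_vertex => //.
- by rewrite !inE negb_or xt andbT; apply: contraNneq as_ => <-.
- by apply: IH => // y yt; apply: ts; rewrite inE yt orbT.
by rewrite (bigD1 a) ?inE ?eqxx //= (leq_trans (four x xs)) ?leq_addr.
Qed.

Lemma size_hub_star a s : size (hub_star a s) = (4 * size s)%N.
Proof. by rewrite /hub_star; elim: s => //= b s ->; lia. Qed.

Lemma mem_hub_star a s p : p \in hub_star a s -> p.1 = a /\ p.2 \in s.
Proof. by move=> /flatten_mapP[b bs]; rewrite mem_nseq => /eqP->. Qed.
End Hubs.

(** * Realising the hub tree in the complement *)

Section Complement.
Variables (T : finType) (e f : rel T).
Hypotheses (se : symmetric e) (sf : symmetric f) (ief : irreflexive f).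
Hypothesis ef : forall x y, x != y -> f x y = ~~ e x y.
Implicit Types (U H A B W : {set T}).

Let fm : simple_mult (edgem f).
Proof. by split=> [u v|v]; rewrite /edgem ?ief // sf. Qed.

Lemma uniq_seq_in (B : {set T}) n : (n <= #|B|)%N ->
  exists bs : seq T, [/\ uniq bs, size bs = n & {subset bs <= B}].
Proof.
move=> nB; exists (take n (enum B)); split.
- by rewrite take_uniq ?enum_uniq.
- by rewrite size_take_min -cardE; apply/minn_idPl.
- by move=> x /mem_take; rewrite mem_enum.
Qed.

Lemma card_avoid H A : (#|H| <= #|[set h in H | [forall a in A, ~~ e a h]]| +
  \sum_(a in A) links e H a)%N.
Proof.
rewrite /links exchange_big /= -!sum1_card big_mkcond [X in (_ <= X + _)%N]big_mkcond.
rewrite [X in (_ <= _ + X)%N]big_mkcond -big_split; apply: leq_sum => h _ /=.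
rewrite inE; case: (h \in H) => //=; case: (boolP [forall a in A, ~~ e a h]) => //=.
rewrite negb_forall => /existsP[a]; rewrite negb_imply negbK => /andP[aA eah].
by rewrite (bigD1 a) //= eah.
Qed.

(** At least 24 - 12 vertices of [H] are joined in [f] to all four hubs, and each has the degree 4
    needed to realise one of the 12 tree edges. Any other vertex of [W] misses at most 3 of these
    12. *)
Lemma four_hubs H W : [disjoint H & W] -> (forall w, w \in W -> links e H w <= 3)%N ->
  (24 <= #|H|)%N -> (4 <= #|W|)%N ->
  exists U, S3on (edgem f) U /\ forall w, w \in W -> (4 <= links f U w)%N \/ w \in U.
Proof.
move=> HW c3 H24 W4.
have [s [us s4 sW]] := uniq_seq_in W4.
case: s us s4 sW => // a s ua [s3] sW.
pose A := [set x in a :: s].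
pose B := [set h in H | [forall a in A, ~~ e a h]].
have AW : A \subset W by apply/subsetP => x; rewrite inE => /sW.
have cA : #|A| = 4%N by rewrite cardsE (card_uniqP ua) /= s3.
have B12 : (12 <= #|B|)%N.
  have := card_avoid H A; rewrite -/B.
  have : (\sum_(a in A) links e H a <= \sum_(a in A) 3)%N.
    by apply: leq_sum => x xA; apply/c3/(subsetP AW).
  by rewrite sum_nat_const cA; lia.
have [bs [ubs sbs bsB]] := uniq_seq_in B12.
have neHW b w : b \in H -> w \in W -> b != w.
  by move=> bH wW; apply: contraTneq wW => <-; rewrite (disjointFr HW bH).
have adj b x : b \in bs -> x \in A -> f b x.
  move=> /bsB; rewrite inE => /andP[bH /forall_inP ne] xA.
  by rewrite ef ?neHW ?(subsetP AW) // se ne.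
have bA b : b \in bs -> b \notin A.
  move=> /bsB; rewrite inE => /andP[bH _]; apply/negP => /(subsetP AW) bW.
  by rewrite (disjointFr HW bH) in bW.
exists (A :|: [set b in bs]); split.
  apply: (@lift_all _ _ _ (hub_star a s)) => //.
  - by rewrite size_hub_star s3 sbs.
  - move=> p /mem_hub_star[-> ps]; rewrite !inE eqxx ps orbT; split=> //.
    by apply: contraTneq ua => ->; rewrite /= ps.
  - move=> b p bbs /mem_hub_star[-> ps].
    by rewrite /edgem !adj // inE ?mem_head // inE ps orbT.
  - move=> b bbs; rewrite -cA -sum1_card; apply: leq_sum => x xA.
    by rewrite /edgem adj.
  - exact: S3on_hub_star.
move=> w wW; case wA: (w \in A); first by right; rewrite inE wA.
left; have : (#|[set b in bs]| <= links f [set b in bs] w + links e H w)%N.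
  rewrite /links -sum1_card [X in (_ <= X + _)%N]big_mkcond.
  rewrite [X in (_ <= _ + X)%N]big_mkcond [X in (X <= _)%N]big_mkcond -big_split.
  apply: leq_sum => b _ /=.
  rewrite inE; case bbs: (b \in bs) => //=; move: (bsB b bbs); rewrite inE => /andP[bH _].
  by rewrite bH ef 1?eq_sym ?neHW //; case: (e w b).
rewrite cardsE (card_uniqP ubs) sbs => l12.
have : (links f [set b in bs] w <= links f (A :|: [set b in bs]) w)%N.
  by rewrite /links [X in (_ <= X)%N](big_setID [set b in bs]) /= (setIidPr (subsetUr _ _)) leq_addr.
by have := c3 w wW; lia.
Qed.

Section ThreeHubs.
Variables (H W : {set T}).
Hypotheses (HW : [disjoint H & W]) (HUW : H :|: W = setT) (W3 : #|W| = 3%N).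
Hypothesis c3 : forall w, w \in W -> (links e H w <= 3)%N.
Hypothesis degf : forall v, (4 <= deg f v)%N.

Let B := [set h in H | [forall w in W, ~~ e w h]].

Let BH : B \subset H.
Proof. by apply/subsetP => x; rewrite inE => /andP[]. Qed.

Let fBW b w : b \in B -> w \in W -> f b w.
Proof.
rewrite inE => /andP[bH /forall_inP ne] wW.
have bw : b != w by apply: contraTneq wW => <-; rewrite (disjointFr HW bH).
by rewrite ef // se ne.
Qed.

Let cardY : (#|H :\: B| <= 9)%N.
Proof.
have := card_avoid H W; rewrite -/B.
have : (\sum_(w in W) links e H w <= \sum_(w in W) 3)%N by apply: leq_sum.
have := cardsID B H; rewrite sum_nat_const W3 (setIidPr BH).
by move: #|B| #|H| #|H :\: B| (\sum_(w in W) _)%N; clear; lia.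
Qed.

Let sum_ge_card (m : T -> T -> nat) (D D' : {set T}) b : D' \subset D ->
  (forall u v, edgem f u v <= m u v)%N -> (forall u, u \in D' -> f b u) ->
  (#|D'| <= \sum_(u in D) m b u)%N.
Proof.
move=> DD ge fb; rewrite (sum_subsetD _ DD) -sum1_card (leq_trans _ (leq_addr _ _)) //.
by apply: leq_sum => u uD; apply: leq_trans (ge b u); rewrite /edgem fb.
Qed.

(* Each step realizes one edge of the hub graph, using at most four vertices of B. *)
Let hub_step U a c (l : seq (T * T)) : W \subset U -> a \in W -> c \in W -> a != c ->
  {in l, forall p : T * T, p.1 != p.2} -> (28 <= #|B :\: U|)%N ->
  S3on (addE (addEs (edgem f) l) a c) U ->
  exists U', [/\ U \subset U', S3on (addEs (edgem f) l) U' & (#|U' :&: B| <= #|U :&: B| + 4)%N].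
Proof.
move=> WU aW cW ac lne B28; set m := addEs (edgem f) l => S3.
have sm : simple_mult m by apply: addEs_simple.
have ge u v : (edgem f u v <= m u v)%N by apply: addEs_ge.
have pos u v : f u v -> (0 < m u v)%N by move=> fuv; apply: leq_trans (ge u v); rewrite /edgem fuv.
have [aU cU] := (subsetP WU a aW, subsetP WU c cW).
have star z (l' : seq (T * T)) (bs : seq T) : z \notin U -> uniq bs -> size bs = size l' ->
    (0 < addEs m l' z a)%N -> (0 < addEs m l' z c)%N -> (4 <= \sum_(u in U) addEs m l' z u)%N ->
    {in l', forall p : T * T, p.1 = z /\ p.2 \in W} ->
    {in bs, forall b, [/\ b \in B, b \notin U, b != z & f b z]} -> ((z \in B) + size bs <= 4)%N ->
    exists U', [/\ U \subset U', S3on m U' & (#|U' :&: B| <= #|U :&: B| + 4)%N].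
  move=> zU ubs sz za zc z4 lz bsP s4; exists ((z |: U) :|: [set b in bs]); split.
  - by rewrite -setUA (subset_trans (subsetUl U [set b in bs])) ?subsetUr.
  - apply: (@star_lift _ _ _ z a c l' bs) => //.
    + by move=> p pl; have [-> pW] := lz p pl; rewrite (subsetP WU).
    + by move=> b /bsP[_ bU bz _]; rewrite !inE negb_or bz.
    + move=> b p /bsP[bB _ _ fbz] /lz[-> pW].
      by rewrite !pos // fBW.
    + move=> b /bsP[bB _ _ fbz]; have c4 : #|z |: W| = 4%N.
        by rewrite cardsU1 W3 (contra (subsetP WU z) zU).
      rewrite -c4; apply: sum_ge_card => //; first exact: setUS.
      by move=> u; rewrite !inE => /orP[/eqP->|uW] //; apply: fBW.
  - have sub : ((z |: U) :|: [set b in bs]) :&: B \subset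
        (U :&: B) :|: (([set z] :&: B) :|: [set b in bs]).
      apply/subsetP => v; rewrite !(in_setI, in_setU, in_set1) [v \in [set b in bs]]in_set.
      by case: (v == z); case: (v \in U); case: (v \in bs); case: (v \in B).
    apply: leq_trans (subset_leq_card sub) _; apply: leq_trans (leq_card_setU _ _) _.
    rewrite leq_add2l; apply: leq_trans (leq_card_setU _ _) _; apply: leq_trans s4.
    have -> : #|[set b in bs]| = size bs by rewrite cardsE; apply/card_uniqP.
    rewrite leq_add2r.
    case zB: (z \in B); first by rewrite (leq_trans (subset_leq_card (subsetIl _ _))) ?cards1.
    rewrite leqn0 cards_eq0; apply/eqP/setP => v; rewrite in_setI in_set1 in_set0.
    by case: eqP => // ->.
have BU b : b \in B :\: U -> b \in B /\ b \notin U by rewrite in_setD => /andP[].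
(* Two leaves are lifted to edges [ya] and two to edges [yc], which gives [y] the degree 4 needed to
   be lifted to [ac]. *)
have take_leaves y : y \notin U -> y \notin W -> (4 <= #|[set b in B :\: U | f b y]|)%N -> y \notin B ->
    exists U', [/\ U \subset U', S3on m U' & (#|U' :&: B| <= #|U :&: B| + 4)%N].
  move=> yU yW N4 yB; have [bs [ubs sbs bsN]] := uniq_seq_in N4.
  have ya : y != a by apply: contraNneq yW => ->.
  have yc : y != c by apply: contraNneq yW => ->.
  pose l' := [:: (y, a); (y, c); (y, a); (y, c)].
  have a2 : (2 <= addEs m l' y a)%N.
    apply: leq_trans (addEs_count _ _ _ _); rewrite /= !xpair_eqE !eqxx /=.
    by move: (c == a) => x; clear; lia.
  have c2 : (2 <= addEs m l' y c)%N.
    apply: leq_trans (addEs_count _ _ _ _); rewrite /= !xpair_eqE !eqxx /=.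
    by move: (a == c) => x; clear; lia.
  apply: (star y l' bs) => //; try exact: leq_trans a2; try exact: leq_trans c2.
  - rewrite (bigD1 a) //= (bigD1 c) /=; last by rewrite cU eq_sym.
    by rewrite addnA (leq_trans _ (leq_addr _ _)) // (leq_add a2 c2).
  - by move=> p; rewrite !inE => /or4P[] /eqP->.
  - move=> b /bsN; rewrite in_set => /andP[/BU[bB bU] fby]; split=> //.
    by apply: contraNneq yB => <-.
  - by rewrite (negPf yB) sbs.
(* With three hubs a vertex of [B] has only three sure edges, one too few for splitting. Here the
   fourth goes to [U], and [b] is lifted directly. *)
case: (boolP [exists b in B :\: U, [exists z in U :\: W, f b z]]) => [|none1].
  case/exists_inP=> b /BU[bB bU] /exists_inP[z]; rewrite in_setD => /andP[zW zU] fbz.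
  exists (b |: U); split; first exact: subsetUr.
    apply: (@S3on_lift _ _ _ b a c) => //; try by rewrite pos ?fBW.
    - by case: sm.
    - by case: sm.
    have c4 : #|z |: W| = 4%N by rewrite cardsU1 W3 zW.
    rewrite -c4; apply: sum_ge_card => //; first by rewrite subUset sub1set zU.
    by move=> u; rewrite in_setU1 => /orP[/eqP->|uW] //; apply: fBW.
  rewrite setIUl (leq_trans (leq_card_setU _ _)) // addnC leq_add2l.
  by rewrite (leq_trans (subset_leq_card (subsetIl _ _))) ?cards1.
have nb2 b : b \in B :\: U -> exists2 z, f b z & z \notin U /\ z \notin W.
  move=> bBU; have [bB bU] := BU b bBU.
  have : (#|W| < #|[set u | f b u]|)%N by rewrite W3; apply: degf.
  move=> lt; have : ~~ ([set u | f b u] \subset W).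
    by apply: contraL lt => /subset_leq_card; rewrite -leqNgt.
  case/subsetPn=> z; rewrite inE => fbz zW; exists z => //; split=> //.
  apply: contra none1 => zU; apply/exists_inP; exists b => //; apply/exists_inP; exists z => //.
  by rewrite in_setD zW.
(* An edge [bz] outside [U] serves as the fourth: lifting [b] to [za] gives [z] a fourth edge too,
   and then [z] is lifted. *)
case: (boolP [exists b in B :\: U, [exists z in B :\: U, f b z]]) => [|none2].
  case/exists_inP=> b /BU[bB bU] /exists_inP[z /BU[zB zU] fbz].
  have pza : (z, a) \in [:: (z, a)] by rewrite inE eqxx.
  have fza : f z a by apply: fBW.
  have fzc : f z c by apply: fBW.
  have pa := addEs_pair m pza.
  apply: (star z [:: (z, a)] [:: b]) => //.
  - exact: leq_trans pa.
  - by apply: leq_trans (addEs_ge _ _ _ _); apply: pos.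
  - rewrite (sum_subsetD _ WU) (leq_trans _ (leq_addr _ _)) // (big_setD1 a aW).
    have c2 : #|W :\ a| = 2%N by have := cardsD1 a W; rewrite W3 aW; clear; lia.
    rewrite -[4%N]/(2 + 2)%N leq_add //; first exact: leq_ltn_trans (pos _ _ fza) pa.
    rewrite -c2; apply: sum_ge_card => // [u v|u /setD1P[_ uW]]; last exact: fBW.
    exact: leq_trans (ge u v) (addEs_ge _ _ _ _).
  - by move=> p; rewrite inE => /eqP->.
  - by move=> b'; rewrite inE => /eqP->; split=> //; apply: contraTneq fbz => ->; rewrite ief.
  - by rewrite zB.
(* All fourth edges now end in [H :\: B], which has at most 9 vertices; since 28 > 9 * 3, one of
   them receives four. *)
have [y yY N4] : exists2 y, y \in (H :\: B) :\: U & (4 <= #|[set b in B :\: U | f b y]|)%N.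
  apply/exists_inP; apply: contraLR B28 => /exists_inPn few; rewrite -ltnNge.
  have le : (#|B :\: U| <= \sum_(y in (H :\: B) :\: U) #|[set b in B :\: U | f b y]|)%N.
    under eq_bigr do rewrite -sum1_card big_mkcond.
    rewrite exchange_big -sum1_card big_mkcond; apply: leq_sum => b _.
    case bBU: (b \in B :\: U) => //; have [z fbz [zU zW]] := nb2 b bBU.
    have zH : z \in H by have := in_setT z; rewrite -HUW in_setU (negPf zW) orbF.
    have zB : z \notin B.
      apply: contra none2 => zB; apply/exists_inP; exists b => //; apply/exists_inP; exists z => //.
      by rewrite in_setD zU.
    rewrite (bigD1 z) /=; last by rewrite !in_setD zU zB.
    by rewrite in_set bBU fbz.
  apply: leq_ltn_trans le _; apply: leq_ltn_trans (_ : 9 * 3 < 28)%N => //.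
  apply: (@leq_trans (\sum_(y in (H :\: B) :\: U) 3)%N).
    by apply: leq_sum => y yY; have := few y yY; rewrite -ltnNge.
  by rewrite sum_nat_const leq_mul2r (leq_trans (subset_leq_card (subsetDl _ _)) cardY).
move: yY; rewrite !in_setD => /andP[yU /andP[yB yH]].
by apply: (take_leaves y yU _ N4 yB); rewrite (disjointFr HW yH).
Qed.

(** The hub tree has 8 edges counted with multiplicity, each costing at most 4 vertices of [B].
    Before any step at most 28 are used, so 61 leave more than the 28 required; 61 itself is 73 - 3
    - 9. *)
Lemma three_hubs : (61 <= #|B|)%N -> exists2 U : {set T}, W \subset U & S3on (edgem f) U.
Proof.
move=> B61; have le3 : (3 <= #|W|)%N by rewrite W3.
have [s [us s3 sW]] := uniq_seq_in le3; case: s us s3 sW => // a s ua [s2] sW.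
have WE : W = [set x in a :: s].
  apply/eqP; rewrite eq_sym eqEcard W3 cardsE (card_uniqP ua) /= s2 leqnn andbT.
  by apply/subsetP => x; rewrite inE => /sW.
have aW : a \in W by rewrite WE inE mem_head.
have lW p : p \in hub_star a s -> [/\ p.1 \in W, p.2 \in W & p.1 != p.2].
  move=> /mem_hub_star[-> ps]; split=> //; first by rewrite WE !inE ps orbT.
  by apply: contraTneq ua => ->; rewrite /= ps.
have S30 := S3on_hub_star fm ua; rewrite -WE in S30.
have WB : #|W :&: B| = 0%N.
  apply/eqP; rewrite cards_eq0 setI_eq0 disjoint_sym (disjointWl BH) //.
suff K l U : {in l, forall p : T * T, [/\ p.1 \in W, p.2 \in W & p.1 != p.2]} ->
    W \subset U -> (#|U :&: B| + 4 * size l <= 32)%N -> S3on (addEs (edgem f) l) U ->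
    exists2 U' : {set T}, W \subset U' & S3on (edgem f) U'.
  by apply: (K (hub_star a s) W) => //; rewrite WB size_hub_star; case: s2 => ->.
elim: l U => [|p l IH] U lP WU le S3; first by exists U.
have [p1 p2 p12] := lP p (mem_head p l).
have lP' : {in l, forall q : T * T, [/\ q.1 \in W, q.2 \in W & q.1 != q.2]}.
  by move=> q ql; apply: lP; rewrite inE ql orbT.
have [||U' [UU' S3' cU']] := @hub_step U p.1 p.2 l WU p1 p2 p12 _ _ S3.
- by move=> q /lP'[].
- have := cardsID U B; rewrite setIC; move: le B61 => /=; clear; lia.
apply: (IH U') => //; first exact: subset_trans UU'.
by move: le cU' => /=; clear; lia.
Qed.
End ThreeHubs.
End Complement.

(** * Comparing the two maximal sets *)

Lemma dichotomy (T : finType) (e f : rel T) (H0 : {set T}) :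
  simple_graph e -> simple_graph f -> (forall x y, x != y -> f x y = ~~ e x y) ->
  (73 <= #|T|)%N -> (forall v, 4 <= deg e v)%N -> (forall v, 4 <= deg f v)%N ->
  (24 <= #|H0|)%N -> S3on (edgem e) H0 ->
  (S3 e \/ S3 f) \/ ([/\ has_bad_attachment e, has_bad_attachment f,
    flow_index_lt3 e & flow_index_lt3 f]).
Proof.
move=> ge gf ef n73 dege degf H24 S30; have [se ie] := ge; have [sf jf] := gf.
have [H HH maxH] := S3max_exists S30.
case: (eqVneq (~: H) set0) => [W0|W0].
  left; left; apply: S3on_S3 => //; case: maxH => + _.
  by have -> : H = setT by rewrite -[H]setCK W0 setC0.
have HW : [disjoint H & ~: H] by rewrite disjoints_subset setCK.
have c3 w : w \in ~: H -> (links e H w <= 3)%N by apply: max_links.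
have [k3 cW _] := max_deficit se ie dege maxH W0.
have H24' : (24 <= #|H|)%N := leq_trans H24 (subset_leq_card HH).
have [U S3U cover] : exists2 U, S3on (edgem f) U &
    forall w, w \in ~: H -> (4 <= links f U w)%N \/ w \in U.
  have [k4|k4] := leqP 4 #|~: H|.
    by have [U [S3U cU]] := four_hubs se sf jf ef HW c3 H24' k4; exists U.
  have k3' : #|~: H| = 3%N by lia.
  have [|U WU S3U] := three_hubs se sf jf ef HW (setUCr H) k3' c3 degf.
    have := card_avoid e H (~: H); have := cardsC H.
    have : (\sum_(w in ~: H) links e H w <= \sum_(w in ~: H) 3)%N by apply: leq_sum.
    rewrite sum_nat_const k3'; move: n73.
    by move: #|H| #|[set h in H | _]| (\sum_(w in _) _)%N #|T|; clear; lia.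
  by exists U => // w wW; right; apply: (subsetP WU).
have [H' UH' maxH'] := S3max_exists S3U.
case: (eqVneq (~: H') set0) => [X0|X0].
  left; right; apply: S3on_S3 => //; case: maxH' => + _.
  by have -> : H' = setT by rewrite -[H']setCK X0 setC0.
have WH' : ~: H \subset H'.
  apply/subsetP => w /cover[c4|/(subsetP UH')//]; apply/negPn/negP => wH'.
  have wX : w \in ~: H' by rewrite inE.
  have := max_links sf jf maxH' wX; apply/negP; rewrite -ltnNge (leq_trans c4) //.
  by rewrite /links (sum_subsetD _ UH') leq_addr.
have XH : ~: H' \subset H by rewrite -[H]setCK setCS.
have [x3 cX _] := max_deficit sf jf degf maxH' X0.
have cross : (#|~: H| * #|~: H'| <=
    \sum_(w in ~: H) links e H w + \sum_(x in ~: H') links f H' x)%N.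
  apply: (@leq_trans (\sum_(w in ~: H) \sum_(x in ~: H') e w x +
      \sum_(x in ~: H') \sum_(w in ~: H) f x w)%N); last first.
    apply: leq_add; apply: leq_sum => v _; rewrite /links.
      by rewrite (sum_subsetD _ XH) leq_addr.
    by rewrite (sum_subsetD _ WH') leq_addr.
  rewrite [X in (_ <= _ + X)%N]exchange_big -big_split -sum_nat_const.
  apply: leq_sum => w wW /=; rewrite -big_split -sum1_card; apply: leq_sum => x xX /=.
  have xw : x != w.
    apply: contraTneq xX => ->; rewrite inE negbK; exact: (subsetP WH').
  by rewrite ef // (se x w); case: (e w x).
(* Both deficits are at least 3 and their sum is at most 9 - (|V - H| - 3)(|V - H'| - 3). *)
have [D6 D6'] : (3 * #|~: H| <= \sum_(w in ~: H) links e H w + 6)%N /\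
    (3 * #|~: H'| <= \sum_(x in ~: H') links f H' x + 6)%N.
  move: k3 x3 cW cX cross.
  move: #|~: H| #|~: H'| (\sum_(w in _) _)%N (\sum_(x in _) _)%N => k x c d.
  by clear; nia.
right; split.
- exact: max_bad maxH W0 D6.
- exact: max_bad maxH' X0 D6'.
- exact: max_flow maxH W0 D6.
- exact: max_flow maxH' X0 D6'.
Qed.

Local Close Scope ring_scope.

Theorem mainTheorem2 (T : finType) (e : rel T) :
  simple_graph e ->
  73 <= #|T| ->
  (forall v, 4 <= deg e v) ->
  (forall v, 4 <= deg (compl_graph e) v) ->
  (S3 e \/ S3 (compl_graph e)) \/
  ([/\ has_bad_attachment e, has_bad_attachment (compl_graph e),
       flow_index_lt3 e & flow_index_lt3 (compl_graph e)]).
Proof.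
move=> ge n73 dege degf; have [se ie] := ge.
have gf : simple_graph (compl_graph e).
  by split=> [x y|x]; rewrite /compl_graph ?eqxx // eq_sym se.
have ef x y : x != y -> compl_graph e x y = ~~ e x y by rewrite /compl_graph => ->.
have fe x y : x != y -> e x y = ~~ compl_graph e x y by move=> xy; rewrite ef ?negbK.
have [K K73] : exists K : {set T}, #|K| = 73.
  have [|s [us s73 _]] := @uniq_seq_in T setT 73; first by rewrite cardsT.
  by exists [set x in s]; rewrite cardsE (card_uniqP us).
have [||u v|H0 H24 [S3e|S3f]] := @S3on_two_coloured T (edgem e) (edgem (compl_graph e)) K _ _ _ K73.
- by move=> u v; rewrite /edgem se.
- by move=> u v; rewrite /edgem; case: gf => ->.
- rewrite /edgem; case: (eqVneq u v) => [->|uv]; last by rewrite ef //; case: (e u v).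
  by rewrite ie /compl_graph eqxx.
- exact: (dichotomy ge gf ef n73 dege degf H24 S3e).
case: (dichotomy gf ge fe n73 degf dege H24 S3f) => [[]|[]]; by [left; right|left; left|right].
Qed.
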